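(* For any simple graph $G$ with at least one edge and chromatic number $\chi(G)$, \[ {\rm La}(n,P(G))\leq\left(1+\sqrt{1-\frac{1}{\chi(G)-1}}+o(1)\right)\binom{n}{\lfloor n/2\rfloor}, \] where $o(1)\to0$ as $n\to\infty$. In particular, if $G$ is bipartite, then ${\rm La}(n,P(G))=(1+o(1))\binom{n}{\lfloor n/2\rfloor}$.
   Context: A poset $(S,\leq)$ contains a poset $(S',\leq')$ if there is an injection $f\colon S'\to S$ such that $u\leq' v$ implies $f(u)\leq f(v)$ (copies need not be induced). For a poset $H$, a family $\mathcal{F}\subseteq 2^{[n]}$ is $H$-free if $(\mathcal{F},\subseteq)$ does not contain $H$, and ${\rm La}(n,H)$ is the maximum size of an $H$-free family of subsets of $[n]$. For a simple graph $G=(V,E)$, $P(G)$ is the poset on $V\cup E$ in which $v<e$ exactly when vertex $v$ is an endpoint of edge $e$, with no other relations. *)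

(* Defs.v *)
From HB Require Import structures.
From mathcomp Require Import all_boot all_order.
From mathcomp Require Import boolp.

Set Implicit Arguments.
Unset Strict Implicit.
Unset Printing Implicit Defensive.

Import Order.TTheory Order.DefaultSetSubsetOrder.

Record sgraph := SGraph {
  vertex :> finType;
  adj : rel vertex;
  adj_sym : symmetric adj;
  adj_irrefl : irreflexive adj
}.

Definition edges (G : sgraph) : {set {set G}} :=
  [set [set p.1; p.2] | p : G * G & adj p.1 p.2].

Definition proper_coloring (G : sgraph) (k : nat) (c : G -> 'I_k) : Prop :=
  forall x y : G, adj x y -> c x != c y.

Definition colorable (G : sgraph) (k : nat) : Prop :=
  exists c : G -> 'I_k, proper_coloring c.

Fact colorable_ex (G : sgraph) : exists k, `[< colorable G k >].
Proof.
exists #|G|; apply/asboolP; exists enum_rank => x y xy.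
by rewrite (inj_eq enum_rank_inj); apply: contraTneq xy => ->; rewrite adj_irrefl.
Qed.

Definition chromatic_number (G : sgraph) : nat := ex_minn (colorable_ex G).

Definition bipartite (G : sgraph) : Prop :=
  exists A : {set G}, forall x y : G, adj x y -> (x \in A) != (y \in A).

(* P(G): the type V + E ordered by incidence; the order relation is the
   reflexive closure of [incidence_lt]. *)
Definition incidence_poset (G : sgraph) : Type :=
  (G + {A : {set G} | A \in edges G})%type.

HB.instance Definition _ (G : sgraph) := Finite.on (incidence_poset G).

Definition incidence_lt (G : sgraph) : rel (incidence_poset G) :=
  fun u w => match u, w with inl v, inr e => v \in val e | _, _ => false end.

Fact incidence_lt_irr (G : sgraph) : irreflexive (@incidence_lt G).
Proof. by case. Qed.

Fact incidence_lt_trans (G : sgraph) : transitive (@incidence_lt G).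
Proof. by move=> [?|?] [?|?] [?|?]. Qed.

Fact incidence_display : Order.disp_t. Proof. exact: (Order.Disp tt tt). Qed.

HB.instance Definition _ (G : sgraph) :=
  Order.Lt_isPOrder.Build incidence_display (incidence_poset G)
    (@incidence_lt_irr G) (@incidence_lt_trans G).

Definition poset_contains (d d' : Order.disp_t)
    (S : porderType d) (S' : porderType d') : Prop :=
  exists2 f : S' -> S, injective f & {homo f : u v / (u <= v)%O}.

(* (F, \subset), with the order on {set _} of [Order.DefaultSetSubsetOrder]. *)
Definition family_poset (n : nat) (F : {set {set 'I_n}}) : Type :=
  {A : {set 'I_n} | A \in F}.

HB.instance Definition _ (n : nat) (F : {set {set 'I_n}}) :=
  SubChoice.on (family_poset F).
HB.instance Definition _ (n : nat) (F : {set {set 'I_n}}) :=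
  [SubChoice_isSubPOrder of family_poset F by <:
     with Order.SetSubsetOrder.subset_display].

Definition poset_free (d : Order.disp_t) (H : porderType d) (n : nat)
    (F : {set {set 'I_n}}) : Prop :=
  ~ poset_contains (family_poset F) H.

(* If H is empty, no family is H-free and this is 0. *)
Definition La (d : Order.disp_t) (n : nat) (H : porderType d) : nat :=
  \max_(F : {set {set 'I_n}} | `[< poset_free H F >]) #|F|.

(* Main.v *)
(** Count along a random maximal chain of subsets of [n].  If [F] is free of
    P(G), then for every set [M] either fewer than |V| + |E| members of [F] lie
    strictly below [M], or fewer than that lie strictly above it: otherwise the
    vertices of [G] can be placed below [M] and the edges above it.  A chain
    through [M] therefore rarely meets [F] on that side.  After discarding
    the levels far from the middle, a random chain meets [F] with probability
    close to 1 at most twice, in two consecutive sets [A] and [B = A + x], where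
    [A] has few members of [F] below it and [B] few above it.  Hence the
    Lubell mass of [F] is at most [1 + p + o(1)], with [p] the probability of
    such a pair.  By Cauchy-Schwarz, [p ^ 2] is at most the probability that [B]
    together with two such subsets [B - x] and [B - y] lies in [F], and this is
    an edge density in the graphs [{x, y} |-> S + x + y] on
    [{x : S + x in F}], which do not contain [G].  By the theorem of Erdos and
    Stone it is at most [1 - 1 / (chi(G) - 1) + o(1)]. *)
Require Import Defs.
From mathcomp Require Import all_boot all_order all_algebra all_fingroup.
From mathcomp Require Import boolp reals.
From mathcomp Require Import ring lra zify.

Set Implicit Arguments.
Unset Strict Implicit.
Unset Printing Implicit Defensive.

Import Order.TTheory GRing.Theory Num.Theory.

(** * Binomial coefficients *)

Lemma leq_bin_proper b a : 0 < a < b -> b <= 'C(b, a).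
Proof.
elim: b a => [|b IHb] [|a] // /andP[_ ab]; rewrite binS.
have [ba|ba] := leqP b a.+1.
  have -> : b = a.+1 by lia.
  by rewrite binn binSn addnC addn1.
have H1 : b <= 'C(b, a.+1) by exact: IHb.
have H2 : 0 < 'C(b, a) by rewrite bin_gt0; lia.
lia.
Qed.

Lemma leq_bin_succ n i : i.*2 < n -> 'C(n, i) <= 'C(n, i.+1).
Proof.
move=> i2; have := mul_bin_left n i.
have : i.+1 * 'C(n, i) <= (n - i) * 'C(n, i) by rewrite leq_mul2r;
  apply/orP; right; lia.
by move=> H E; move: H; rewrite -E leq_pmul2l.
Qed.

Lemma leq_bin_below n i j : i <= j -> j <= n./2 -> 'C(n, i) <= 'C(n, j).
Proof.
move=> /subnK <-; elim: (j - i) => //= k IHk kn.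
apply: leq_trans (IHk _) _; first by lia.
by apply: leq_bin_succ; lia.
Qed.

Lemma leq_bin_half n k : 'C(n, k) <= 'C(n, n./2).
Proof.
have [kn|nk] := leqP k n; last by rewrite bin_small.
have [kh|hk] := leqP k n./2; first exact: leq_bin_below.
by rewrite -bin_sub //; apply: leq_bin_below; lia.
Qed.

Lemma bin_trinomial n b a : a <= b -> b <= n ->
  'C(n, b) * 'C(b, a) = 'C(n, a) * 'C(n - a, b - a).
Proof.
move=> ab bn; have F : 0 < a`! * ((b - a)`! * (n - b)`!)
  by rewrite !muln_gt0 !fact_gt0.
apply/eqP; rewrite -(eqn_pmul2r F); apply/eqP.
have := bin_fact bn; have := bin_fact ab; have := bin_fact (leq_trans ab bn).
have := @bin_fact (n - a) (b - a) _.
rewrite (_ : n - a - (b - a) = n - b); last by lia.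
move=> /(_ _) H1 H2 H3 H4.
have {}H1 : 'C(n - a, b - a) * ((b - a)`! * (n - b)`!) = (n - a)`! by apply: H1; lia.
transitivity (n`!); first by rewrite -H4 -H3; nia.
by rewrite -H2 -H1; nia.
Qed.

(** Bernoulli's inequality for $(1 + 1/q)^a$, with denominators cleared. *)
Lemma bernoulli_nat q a : (a + q) * q ^ a <= q * q.+1 ^ a.
Proof.
elim: a => [|a IHa]; first by rewrite !expn0 add0n.
rewrite !expnS; move: IHa; move: (q ^ a) (q.+1 ^ a) => x y; nia.
Qed.

Lemma bin_tail n q a s t : 0 < q -> a.*2 + s <= t -> t <= n./2 -> n./2
  <= s * q.*2.+1 ->
  'C(n, n./2 - t) * a ^ 2 <= q ^ 2 * 'C(n, n./2).
Proof.
move=> q0 ast tn ns.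
have step i : i + s < n./2 -> q.+1 * 'C(n, i) <= q * 'C(n, i.+1).
  move=> is_; have E := mul_bin_left n i.
  have : (i.+1 * q.+1) * 'C(n, i) <= (n - i) * q * 'C(n, i).
    by rewrite leq_mul2r; apply/orP; right; nia.
  move=> H; rewrite -(@leq_pmul2l i.+1) //; nia.
have steps j : j + s <= t -> q.+1 ^ j * 'C(n, n./2 - t)
  <= q ^ j * 'C(n, n./2 - t + j).
  elim: j => [|j IHj] js; first by rewrite !expn0 addn0.
  rewrite addnS !expnS -mulnA.
  apply: leq_trans (_ : q.+1 * (q ^ j * 'C(n, n./2 - t + j)) <= _).
    by rewrite leq_pmul2l //; apply: IHj; lia.
  rewrite mulnCA [q * _]mulnC -mulnA leq_pmul2l ?expn_gt0 ?q0 //.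
  by apply: step; lia.
have H := steps _ ast.
have H2 : 'C(n, n./2 - t + a.*2) <= 'C(n, n./2) by exact: leq_bin_half.
have B := bernoulli_nat q a.
have Q0 : 0 < q ^ a by rewrite expn_gt0 q0.
have E1 : q ^ a.*2 = q ^ a * q ^ a by rewrite -addnn expnD.
have E2 : q.+1 ^ a.*2 = q.+1 ^ a * q.+1 ^ a by rewrite -addnn expnD.
rewrite E1 E2 in H; rewrite -!mulnn.
move: (q ^ a) (q.+1 ^ a) B Q0 H H2 => x y B x0.
move: ('C(n, _)) ('C(n, _)) ('C(n, _)) => w v u H vw.
have B1 : a * x <= q * y by nia.
have B2 : (a * x) * (a * x) <= (q * y) * (q * y) by exact: leq_mul.
rewrite -(@leq_pmul2l (x * x)); last by rewrite muln_gt0 x0.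
have -> : x * x * (u * (a * a)) = u * ((a * x) * (a * x)) by lia.
apply: leq_trans (leq_mul (leqnn u) B2) _.
have -> : u * (q * y * (q * y)) = (q * q) * (y * y * u) by lia.
apply: leq_trans (leq_mul (leqnn (q * q)) H) _.
have -> : q * q * (x * x * v) = x * x * (q * q) * v by lia.
by rewrite [x * x * (q * q * w)]mulnA leq_mul2l vw orbT.
Qed.

Local Open Scope ring_scope.

(** * The Erdos-Stone theorem by homomorphism counting *)

(** Lagrange's identity: the double sum of $(a_i b_j - a_j b_i)^2$ is twice the difference of the
    two sides. *)
Lemma cauchy_schwarz_sum (R : realDomainType) (T : finType) (P : pred T)
    (a b : T -> R) :
  (\sum_(i | P i) a i * b i) ^+ 2 <=
  (\sum_(i | P i) a i ^+ 2) * (\sum_(i | P i) b i ^+ 2).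
Proof.
have H : 0 <= \sum_(i | P i) \sum_(j | P j) (a i * b j - a j * b i) ^+ 2.
  by apply: sumr_ge0 => i _; apply: sumr_ge0 => j _; rewrite sqr_ge0.
have E : \sum_(i | P i) \sum_(j | P j) (a i * b j - a j * b i) ^+ 2 =
   ((\sum_(i | P i) a i ^+ 2) * (\sum_(i | P i) b i ^+ 2) -
    (\sum_(i | P i) a i * b i) ^+ 2) *+ 2.
  have e1 : \sum_(i | P i) \sum_(j | P j) a i ^+ 2 * b j ^+ 2 =
     (\sum_(i | P i) a i ^+ 2) * (\sum_(i | P i) b i ^+ 2).
    by rewrite big_distrlr.
  have e2 : \sum_(i | P i) \sum_(j | P j) a j ^+ 2 * b i ^+ 2 =
     (\sum_(i | P i) a i ^+ 2) * (\sum_(i | P i) b i ^+ 2).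
    by rewrite exchange_big big_distrlr.
  have e3 : \sum_(i | P i) \sum_(j | P j) (a i * b i) * (a j * b j) =
     (\sum_(i | P i) a i * b i) ^+ 2.
    by rewrite expr2 big_distrlr.
  rewrite mulr2n -{1}e1 -e2 -e3 -!sumrB -big_split /=.
  apply: eq_bigr => i _; rewrite -!sumrB -big_split /=.
  by apply: eq_bigr => j _; ring.
by move: H; rewrite E pmulrn_lge0 // subr_ge0.
Qed.

(** * Counting maps by resampling one coordinate *)

Section Resampling.
Variables (R : realType) (V I : finType).
Implicit Types (w : {ffun I -> V}) (i j : I) (f g : {ffun I -> V} -> bool).

Definition upd w i v : {ffun I -> V} := [ffun k => if k == i then v else w k].

Lemma upd_same w i v : upd w i v i = v. Proof. by rewrite ffunE eqxx. Qed.
Lemma upd_other w i v k : k != i -> upd w i v k = w k.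
Proof. by rewrite ffunE => /negbTE ->. Qed.
Lemma updC w i j u v : i != j -> upd (upd w i u) j v = upd (upd w j v) i u.
Proof.
move=> ij; apply/ffunP => k; rewrite !ffunE.
by case: (eqVneq k i) => [->|_] //; rewrite (negbTE ij).
Qed.
Lemma upd_upd w i u v : upd (upd w i u) i v = upd w i v.
Proof. by apply/ffunP => k; rewrite !ffunE; case: (k == i). Qed.
Lemma upd_id w i : upd w i (w i) = w.
Proof. by apply/ffunP => k; rewrite !ffunE; case: eqP => [->|]. Qed.

(** Exchanging [v] with [w i] is an involution on pairs [(w, v)], so replacing a coordinate by an
    independent uniform value preserves averages. *)
Lemma sum_resample (h : {ffun I -> V} -> R) i :
  #|V|%:R * \sum_w h w = \sum_w \sum_v h (upd w i v).
Proof.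
rewrite pair_big /=.
rewrite (reindex_inj (h :=
  fun p : {ffun I -> V} * V => (upd p.1 i p.2, p.1 i))) /=; last first.
  apply: (can_inj (g := fun p : {ffun I -> V} * V => (upd p.1 i p.2, p.1 i))).
  by move=> [w v] /=; rewrite upd_upd upd_id upd_same.
under [RHS]eq_bigr do rewrite upd_upd upd_id.
rewrite -(pair_big xpredT xpredT (fun w (v : V) => h w)) /= mulr_sumr.
by apply: eq_bigr => w _; rewrite sumr_const mulr_natl.
Qed.

(** The probability of [f] for a uniform [w], scaled by $|V|^{|I|}$. *)
Definition mass f : R := \sum_w (f w)%:R.

Lemma mass_ge0 f : 0 <= mass f.
Proof. exact: sumr_ge0. Qed.

Lemma mass_le f g : (forall w, f w -> g w) -> mass f <= mass g.
Proof.
move=> fg; apply: ler_sum => w _; rewrite ler_nat.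
by case: (f w) (fg w) => // ->.
Qed.

Lemma mass_true : mass xpredT = (#|V| ^ #|I|)%:R.
Proof. by rewrite /mass sumr_const -[RHS]mulr1 -card_ffun mulr_natl. Qed.

(* The resampled coordinate [w j] is an independent copy of [w i], so the right
   hand side contains the second moment of the conditional mass of [f]. *)
Lemma mass_duplicate f g i j : i != j -> (0 < #|V|)%N ->
    (forall w v, f (upd w j v) = f w) -> (forall w v, g (upd w i v) = g w) ->
    (forall w, f w -> g w) ->
  mass f ^+ 2 <= mass (fun w => f w && f (upd w i (w j))) * mass g.
Proof.
move=> ij V0 fj gi fg; set N : R := #|V|%:R.
have N0 : 0 < N by rewrite ltr0n.
pose h w : R := \sum_v (f (upd w i v))%:R.
have e1 : N * mass f = \sum_w h w by rewrite /mass (sum_resample _ i).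
have e2 : N * mass (fun w => f w && f (upd w i (w j))) = \sum_w (f w)%:R * h w.
  rewrite /mass (sum_resample _ j); apply: eq_bigr => w _.
  rewrite mulr_sumr; apply: eq_bigr => v _.
  rewrite upd_same fj updC; last by rewrite eq_sym.
  by rewrite fj -natrM mulnb.
have e3 : N * \sum_w (f w)%:R * h w = \sum_w h w ^+ 2.
  rewrite (sum_resample _ i); apply: eq_bigr => w _.
  have hi v : h (upd w i v) = h w.
    by apply: eq_bigr => u _; rewrite upd_upd.
  by under eq_bigr do rewrite hi; rewrite -mulr_suml expr2.
(* Since [f] implies [g] and [g] ignores coordinate [i], [h] vanishes where [g] fails.
   Cauchy-Schwarz then costs only [mass g], not the whole space. *)
have hg w : h w = h w * (g w)%:R.
  rewrite /h mulr_suml; apply: eq_bigr => v _.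
  case: (boolP (f _)) => [/fg|]; last by rewrite mul0r.
  by rewrite gi => ->; rewrite mulr1.
have := cauchy_schwarz_sum xpredT h (fun w => (g w)%:R).
under eq_bigr do rewrite -hg.
rewrite -e1 -e3 -e2.
have -> : \sum_w (g w)%:R ^+ 2 = mass g.
  by apply: eq_bigr => w _; case: (g w); rewrite ?expr1n ?expr0n.
have NN : 0 < N ^+ 2 by rewrite exprn_gt0.
move=> H; rewrite -(ler_pM2l NN) -exprMn (le_trans H) // le_eqVlt; apply/orP; left.
by apply/eqP; ring.
Qed.

(** Two distinct coordinates are independent and uniform; resampling both removes [w] from the
    summand. *)
Lemma mass_point (P : rel V) i j : i != j ->
  #|V|%:R ^+ 2 * mass (fun w => P (w i) (w j)) =
  #|[set p : V * V | P p.1 p.2]|%:R * (#|V| ^ #|I|)%:R.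
Proof.
move=> ij; rewrite expr2 -mulrA /mass (sum_resample _ i).
under eq_bigr => w _ do under eq_bigr => v _ do
  rewrite upd_same upd_other 1?eq_sym //.
rewrite (sum_resample _ j).
under eq_bigr => w _ do under eq_bigr => v _ do rewrite upd_same.
rewrite sumr_const card_ffun [RHS]mulr_natr; congr (_ *+ _).
rewrite exchange_big pair_big /= -sum1_card natr_sum [RHS]big_mkcond /=.
by apply: eq_bigr => p _; rewrite inE; case: (P _ _).
Qed.

End Resampling.

(** * Cliques and complete multipartite subgraphs *)

Section Multipartite.
Variables (R : realType) (V I : finType) (C : eqType) (col : I -> C) (e : rel V).
Hypothesis e_sym : symmetric e.
Hypothesis V_gt0 : (0 < #|V|)%N.
Implicit Types (w : {ffun I -> V}) (i j : I) (Z W : {set I}).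

(** On [Z], [w] is a homomorphism into [e] from the complete multipartite graph whose parts are the
    colour classes; it need not be injective. When [col] is injective on [Z], the source is a
    clique. *)
Definition multipartite Z w :=
  [forall a in Z, forall b in Z, (col a != col b) ==> e (w a) (w b)].

Local Notation K := multipartite.
Local Notation mass := (@mass R V I).

Lemma multipartiteP Z w :
  reflect {in Z &, forall a b, col a != col b -> e (w a) (w b)} (K Z w).
Proof.
apply: (iffP forall_inP) => [H a b aZ bZ ab | H a aZ].
  by have /forall_inP/(_ b bZ)/implyP := H a aZ; apply.
by apply/forall_inP => b bZ; apply/implyP; exact: H.
Qed.

Lemma multipartite_upd Z w i v : i \notin Z -> K Z (upd w i v) = K Z w.
Proof.
move=> iZ; apply/multipartiteP/multipartiteP => H a b aZ bZ ab;
  have := H a b aZ bZ ab; rewrite !upd_other //;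
  by [apply: contraNneq iZ => <- | ].
Qed.

Lemma multipartite_sub Z W w : Z \subset W -> K W w -> K Z w.
Proof.
move=> /subsetP ZW /multipartiteP H; apply/multipartiteP => a b aZ bZ.
by apply: H; exact: ZW.
Qed.

(** [w j] serves as an independent copy of [w i]; no edge between them is required, as their colours
    agree. In terms of densities, a new copy at worst squares. *)
Lemma mass_multipartite_copy Z i j : i \in Z -> j \notin Z -> col i = col j ->
  mass (K Z) ^+ 2 <= mass (K (j |: Z)) * (#|V| ^ #|I|)%:R.
Proof.
move=> iZ jZ cij.
have ij : i != j by apply: contraNneq jZ => <-.
rewrite -mass_true.
apply: le_trans (mass_duplicate R (g := xpredT) ij V_gt0 _ _ _) _ => //.
  by move=> w v; exact: multipartite_upd.
apply: ler_wpM2r; first exact: mass_ge0.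
apply: mass_le => w /andP[/multipartiteP H1 /multipartiteP H2].
have H b : b \in Z -> col j != col b -> e (w j) (w b).
  move=> bZ cjb; have := H2 i b iZ bZ; rewrite cij => /(_ cjb).
  by rewrite upd_same upd_other //; apply: contraNneq cjb => ->; rewrite cij.
apply/multipartiteP => a b /setU1P[->|aZ] /setU1P[->|bZ]; rewrite ?eqxx //.
- exact: H.
- by move=> ab; rewrite e_sym; apply: H => //; rewrite eq_sym.
- exact: H1.
Qed.

(* Moon and Moser: for a clique on [W], a vertex [w j] extends the cliques
   obtained by deleting one vertex for at most one choice of that vertex, unless
   it extends the clique itself. *)
Lemma moon_moser W j (rho : R) : {in j |: W &, injective col} -> j \notin W ->
    0 < rho ->
    (forall i, i \in W -> rho * mass (K (W :\ i)) <= mass (K W)) ->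
  (#|W|%:R * rho - 1) * mass (K W) <= (#|W|%:R - 1) * mass (K (j |: W)).
Proof.
move=> colI jW rho0 Hrho.
have colW a b : a \in W -> b \in W -> a != b -> col a != col b.
  move=> aW bW; apply: contra_neq => /colI; apply; exact: setU1r.
pose D i w := K W w && K W (upd w i (w j)).
have HD i : i \in W -> rho * mass (K W) <= mass (D i).
  move=> iW.
  have ij : i != j by apply: contraNneq jW => <-.
  have [/eqP m0|mN0] := boolP (mass (K W) == 0).
    by rewrite m0 mulr0 mass_ge0.
  have m0 : 0 < mass (K W) by rewrite lt_def mN0 mass_ge0.
  have := mass_duplicate R (f := K W) (g := K (W :\ i)) ij V_gt0.
  move=> /(_ _ _ _)H.
  have {}H : mass (K W) ^+ 2 <= mass (D i) * mass (K (W :\ i)).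
    apply: H => [w v|w v|w]; first exact: multipartite_upd.
      by apply: multipartite_upd; rewrite !inE eqxx.
    by apply: multipartite_sub; rewrite subD1set.
  rewrite -(ler_pM2r m0) -mulrA -expr2.
  apply: le_trans (_ : rho * (mass (D i) * mass (K (W :\ i))) <= _).
    by rewrite ler_pM2l.
  by rewrite mulrCA; apply: ler_wpM2l (Hrho _ iW); exact: mass_ge0.
have sumD : \sum_(i in W) mass (D i) <=
    mass (K W) + (#|W|%:R - 1) * mass (K (j |: W)).
  rewrite /mass exchange_big mulr_sumr -big_split /=.
  apply: ler_sum => w _.
  case: (boolP (K W w)) => [KW|KW]; last first.
    have -> : K (j |: W) w = false.
      by apply: contraNF KW; apply: multipartite_sub; exact: subsetUr.
    rewrite mulr0 addr0 big1 // => i _.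
    by rewrite /D (negbTE KW).
  case: (boolP (K (j |: W) w)) => [_|NK].
    rewrite mulr1 addrC subrK -sumr_const.
    by apply: ler_sum => i _; rewrite lern1 leq_b1.
  rewrite mulr0 addr0.
  have [l lW Hl] : exists2 l, l \in W & ~~ e (w j) (w l).
    apply/exists_inP; apply: contraNT NK; rewrite negb_exists_in => /forall_inP H.
    have {}H b : b \in W -> e (w j) (w b) by move/H; rewrite negbK.
    move/multipartiteP: KW => KW.
    apply/multipartiteP => a b /setU1P[->|aZ] /setU1P[->|bZ]; rewrite ?eqxx //.
    - by move=> _; exact: H.
    - by move=> _; rewrite e_sym; exact: H.
    - exact: KW.
  rewrite (bigD1 l) //= big1 ?addr0; first by rewrite lern1 leq_b1.
  move=> i /andP[iW il]; suff /negbTE -> : ~~ D i w by [].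
  rewrite /D KW /=; apply: contra Hl =>
    /multipartiteP/(_ i l iW lW (colW _ _ iW lW il)).
  by rewrite upd_same upd_other // eq_sym.
rewrite mulrBl mul1r lerBlDl; apply: le_trans sumD.
rewrite -mulrA mulr_natl -sumr_const; apply: ler_sum => i iW; exact: HD.
Qed.

(** By induction through [moon_moser], starting from the edge density, cliques on [w + 2] points are
    at least $1 - (w+1)/r + d$ times as frequent as on [w + 1] points. With at most [r + 1] points
    every such ratio is at least [d]. *)
Lemma supersaturation (r : nat) (d : R) Z :
    (0 < r)%N -> 0 < d -> {in Z &, injective col} -> (#|Z| <= r.+1)%N ->
    (0 < #|Z|)%N ->
    (1 - 1 / r%:R + d) * #|V|%:R ^+ 2 <=
      #|[set p : V * V | e p.1 p.2]|%:R ->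
  d ^+ #|Z|.-1 * (#|V| ^ #|I|)%:R <= mass (K Z).
Proof.
move=> r0 d0 colI Zr Z0 He.
have r0' : 0 < r%:R :> R by rewrite ltr0n.
have N0 : 0 < #|V|%:R :> R by rewrite ltr0n.
have card1 W : #|W| = 1%N -> mass (K W) = (#|V| ^ #|I|)%:R.
  move=> /eqP/cards1P[i ->]; rewrite -mass_true; apply: eq_bigr => w _.
  suff -> : K [set i] w by [].
  by apply/multipartiteP => a b /set1P -> /set1P ->; rewrite eqxx.
have step (w : nat) : forall W i, W \subset Z -> #|W| = w.+2 -> i \in W ->
    (1 - w.+1%:R / r%:R + d) * mass (K (W :\ i)) <= mass (K W).
  elim: w => [|w IHw] W j WZ cW jW.
    have cW1 : #|W :\ j| = 1%N by move: cW; rewrite (cardsD1 j) jW => -[].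
    rewrite card1 //.
    have [i Wi] : exists i, W :\ j = [set i] by apply/cards1P/eqP.
    have /setD1P[ij iW] : i \in W :\ j by rewrite Wi set11.
    have cij : col i != col j.
      by apply: contra_neq ij => /colI; apply; exact: (subsetP WZ).
    rewrite -(ler_pM2l (exprn_gt0 2 N0)) mulrA [_ ^+ 2 * _]mulrC.
    apply: le_trans (ler_wpM2r (ler0n _ _) He) _; rewrite -(mass_point R e ij).
    rewrite ler_pM2l ?exprn_gt0 //; apply: mass_le => v vij.
    have WE : W = [set j; i] by rewrite -Wi setD1K.
    apply/multipartiteP => a b; rewrite WE => /set2P[]-> /set2P[]->; rewrite ?eqxx //.
    by rewrite e_sym.
  have cW1 : #|W :\ j| = w.+2 by move: cW; rewrite (cardsD1 j) jW => -[].
  have jWj : j \notin W :\ j by rewrite !inE eqxx.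
  have wr : (w.+2 <= r)%N.
    by rewrite -ltnS -cW; apply: leq_trans Zr; exact: subset_leq_card.
  have rho0 : 0 < 1 - w.+1%:R / r%:R + d.
    have : w.+1%:R / r%:R <= 1 :> R.
      by rewrite ler_pdivrMr // mul1r ler_nat ltnW.
    by lra.
  have := @moon_moser (W :\ j) j _ _ jWj rho0.
  rewrite setD1K // cW1 => /(_ _ _)H.
  have {}H : (w.+2%:R * (1 - w.+1%:R / r%:R + d) - 1) * mass (K (W :\ j)) <=
      (w.+2%:R - 1) * mass (K W).
    apply: H; first by move=> a b aW bW; apply: colI; exact: (subsetP WZ).
    by move=> i iW; apply: IHw => //; apply: subset_trans WZ; exact: subD1set.
  have w0 : 0 < w.+1%:R :> R by rewrite ltr0n.
  rewrite -(ler_pM2l w0) mulrA.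
  have -> : w.+1%:R * mass (K W) = (w.+2%:R - 1) * mass (K W).
    by rewrite -[w.+2%:R]natr1 addrK.
  apply: le_trans H; apply: ler_wpM2r; first exact: mass_ge0.
  rewrite -[w.+2%:R]natr1 -subr_ge0.
  (* The recursion for the ratios is exact apart from [d]: the difference of the two coefficients is
     [d] itself. *)
  set x := w.+1%:R; have -> : (x + 1) * (1 - x / r%:R + d) - 1 - x * (1
    - (x + 1) / r%:R + d) = d.
    by ring.
  exact: ltW.
suff H k : forall W, W \subset Z -> #|W| = k.+1 ->
    d ^+ k * (#|V| ^ #|I|)%:R <= mass (K W).
  by apply: H => //; rewrite prednK.
elim: k => [|k IHk] W WZ cW; first by rewrite expr0 mul1r card1.
have [i iW] : exists i, i \in W by apply/card_gt0P; rewrite cW.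
have cW1 : #|W :\ i| = k.+1 by move: cW; rewrite (cardsD1 i) iW => -[].
apply: le_trans (step k W i WZ cW iW).
rewrite exprS -mulrA; apply: ler_pM.
- exact: ltW.
- by rewrite mulr_ge0 // exprn_ge0 // ltW.
- have : k.+1%:R / r%:R <= 1 :> R.
    rewrite ler_pdivrMr // mul1r ler_nat -ltnS -cW.
    by apply: leq_trans Zr; exact: subset_leq_card.
  by lra.
- by apply: IHk => //; apply: subset_trans WZ; exact: subD1set.
Qed.
End Multipartite.

(** Union bound over pairs of coordinates, each pair coinciding with probability $1/|V|$. *)
Lemma mass_noninjective (R : realType) (V I : finType) :
  #|V|%:R * mass R (fun w : {ffun I -> V} => ~~ injectiveb w) <=
  (#|I| ^ 2)%:R * (#|V| ^ #|I|)%:R.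
Proof.
have [V0|V0] := posnP #|V|; first by rewrite V0 mul0r mulr_ge0.
have N0 : 0 < #|V|%:R :> R by rewrite ltr0n.
have H : mass R (fun w : {ffun I -> V} => ~~ injectiveb w) <=
   \sum_(i : I) \sum_(j | j != i) mass R (fun w : {ffun I -> V} => w i == w j).
  under [leRHS]eq_bigr do rewrite exchange_big.
  rewrite /= exchange_big; apply: ler_sum => w _ /=.
  case: (boolP (injectiveb w)) => [_|/injectivePn[i [j ij wij]]].
    by apply: sumr_ge0 => i _; apply: sumr_ge0.
  rewrite (bigD1 i) //= (bigD1 j) //= 1?eq_sym // wij eqxx -addrA lerDl.
  by rewrite addr_ge0 //; [|apply: sumr_ge0 => k _]; apply: sumr_ge0.
rewrite -(ler_pM2l N0) in H.
apply: le_trans H _; rewrite -(ler_pM2l N0) mulrA -expr2.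
rewrite mulr_sumr.
have E i j : j != i -> #|V|%:R ^+ 2 * mass R (fun w : {ffun I -> V} => w i == w j) =
    #|V|%:R * (#|V| ^ #|I|)%:R.
  move=> ij; rewrite (mass_point R (fun x y : V => x == y)) 1?eq_sym //.
  congr (_%:R * _).
  have -> : [set p : V * V | p.1 == p.2] = [set (x, x) | x : V].
    apply/setP => -[x y]; rewrite inE /=; apply/eqP/imsetP => [->|[z _ [-> ->]] //].
    by exists y.
  by rewrite card_imset // => x y [].
apply: le_trans (_ : \sum_(i : I) \sum_(j : I) #|V|%:R * (#|V| ^ #|I|)%:R <= _).
  apply: ler_sum => i _; rewrite mulr_sumr big_mkcond /=; apply: ler_sum => j _.
  by case: ifP => [/E -> //|_]; rewrite mulr_ge0.
rewrite !sumr_const -mulrnA -[_ *+ _]mulr_natr mulnn -!mulrA.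
by rewrite [(#|V| ^ _)%:R * _]mulrC.
Qed.

(** Supersaturation gives many cliques with one point per colour. The vertices of [G] are then added
    one at a time, each as a copy of the point of its colour. The remaining density is positive and
    independent of [V], so for large [V] it exceeds that of the non-injective maps. *)
Lemma erdos_stone (R : realType) (G : sgraph) (r : nat) (d : R) :
    (0 < r)%N -> 0 < d -> colorable G r.+1 ->
  exists n0 : nat, forall (V : finType) (e : rel V), symmetric e ->
    (n0 <= #|V|)%N ->
    (1 - 1 / r%:R + d) * #|V|%:R ^+ 2 <=
      #|[set p : V * V | e p.1 p.2]|%:R ->
  exists2 phi : G -> V, injective phi &
    forall x y, adj x y -> e (phi x) (phi y).
Proof.
(* One coordinate for each colour, carrying the initial clique, and one for each vertex of [G]. *)
move=> r0 d0 [c cP]; pose I : finType := ('I_r.+1 + G)%type.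
pose col (a : I) : 'I_r.+1 := match a with inl i => i | inr v => c v end.
(* [c0] is the clique density from [supersaturation]; each of the [#|G|] copies squares it. *)
pose c0 : R := d ^+ r; pose b := c0 ^+ (2 ^ #|G|).
have c00 : 0 < c0 by exact: exprn_gt0.
have b0 : 0 < b by exact: exprn_gt0.
have [n0 Hn0] : exists n0 : nat, (#|I| ^ 2)%:R / b < n0%:R.
  exists (Num.truncn ((#|I| ^ 2)%:R / b)).+1; exact: truncnS_gt.
exists (maxn 1 n0) => V e e_sym; rewrite geq_max => /andP[V0 Vn0] He.
pose Om : R := (#|V| ^ #|I|)%:R.
have Om0 : 0 < Om by rewrite ltr0n expn_gt0 V0.
pose Z (s : seq G) : {set I} :=
  [set a : I | match a with inl _ => true | inr v => v \in s end].
have ZE s v : Z (v :: s) = (inr v : I) |: Z s.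
  by apply/setP => -[i|u]; rewrite !inE.
have HZ s : uniq s -> c0 ^+ (2 ^ size s) * Om <= mass R (multipartite col e (Z s)).
  elim: s => [_|v s IHs /= /andP[vs us]].
    have Z0 : Z [::] = [set inl i | i : 'I_r.+1].
      apply/setP => -[i|u]; rewrite !inE /=; first by rewrite imset_f.
      by apply/esym/imsetP => -[].
    have cZ : #|Z [::]| = r.+1 by rewrite Z0 card_imset ?card_ord // => i j [].
    have -> : c0 ^+ (2 ^ size ([::] : seq G)) = d ^+ #|Z [::]|.-1 by rewrite cZ expr1.
    apply: (supersaturation e_sym V0 r0 d0 _ _ _ He); rewrite ?cZ //.
    by rewrite Z0 => a b' /imsetP[i _ ->] /imsetP[j _ ->] /= ->.
  have H := @mass_multipartite_copy R V I _ col e e_sym V0 (Z s) (inl (c v)) (inr v).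
  rewrite ZE -(ler_pM2r Om0).
  apply: le_trans (H _ _ _); rewrite ?inE //=.
  rewrite -mulrA -expr2 expnS mulnC exprM -exprMn.
  by apply: lerXn2r (IHs us); rewrite nnegrE ?mass_ge0 // mulr_ge0 ?ltW ?exprn_gt0.
have ZT : Z (enum G) = setT by apply/setP => -[i|u]; rewrite !inE ?mem_enum.
have := HZ _ (enum_uniq G); rewrite ZT -cardE => HT.
have Hni := mass_noninjective R V I.
have [w /andP[/injectiveP wi /multipartiteP wK]] :
    exists w : {ffun I -> V}, injectiveb w && multipartite col e setT w.
  apply/existsP; apply: contraT; rewrite negb_exists => /forallP Hall.
  have : mass R (multipartite col e setT) <=
      mass R (fun w : {ffun I -> V} => ~~ injectiveb w).
    by apply: mass_le => w Hw; move: (Hall w); rewrite Hw andbT.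
  move=> /(le_trans HT).
  rewrite -(ler_pM2l (_ : 0 < #|V|%:R)) ?ltr0n // => /le_trans/(_ Hni).
  rewrite mulrA ler_pM2r // leNgt => /negP[].
  rewrite -ltr_pdivrMr //; apply: lt_le_trans Hn0 _; by rewrite ler_nat.
exists (fun x => w (inr x)) => [x y /wi[] //|x y xy].
by apply: wK; rewrite ?inE //=; exact: cP.
Qed.

(** * Random maximal chains *)

(** List the smaller set, then the rest of the larger one, then the complement. Matching positions
    in the lists of the two flags defines the permutation. *)
Lemma perm_flag (T : finType) (A B A' B' : {set T}) :
    A \subset B -> A' \subset B' -> #|A| = #|A'| -> #|B| = #|B'| ->
  exists p : {perm T}, p @: A = A' /\ p @: B = B'.
Proof.
move=> AB AB' cA cB.
pose fl (X Y : {set T}) := (enum X ++ enum (Y :\: X)) ++ enum (~: Y).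
have flsize (X Y : {set T}) : X \subset Y -> size (fl X Y) = #|T|.
  move=> XY; rewrite !size_cat -!cardE cardsD (setIidPr XY) subnKC;
    last exact: subset_leq_card.
  exact: cardsC.
have flmem (X Y : {set T}) x : x \in fl X Y.
  by rewrite !mem_cat !mem_enum !inE; case: (x \in X); case: (x \in Y).
have fluniq (X Y : {set T}) : X \subset Y -> uniq (fl X Y).
  move=> /subsetP XY; rewrite !cat_uniq !enum_uniq /= !andbT; apply/andP; split.
    by apply/hasPn => x; rewrite !mem_enum !inE => /andP[].
  apply/hasPn => x; rewrite mem_cat !mem_enum !inE => xY.
  by rewrite (negbTE xY) andbF orbF; apply: contra xY; exact: XY.
pose s1 := fl A B; pose s2 := fl A' B'.
pose f x := nth x s2 (index x s1).
have sz : size s1 = size s2 by rewrite !flsize.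
have ix x : (index x s1 < size s2)%N by rewrite -sz index_mem flmem.
have finj : injective f.
  move=> x y; rewrite /f (set_nth_default y x) // => /eqP.
  rewrite nth_uniq ?fluniq // => /eqP/(congr1 (nth x s1)).
  by rewrite !nth_index ?flmem.
exists (perm finj).
have sub (X X' : {set T}) : #|X| = #|X'| -> (forall x, x \in X -> f x \in X') ->
    perm finj @: X = X'.
  move=> cX XX'; apply/eqP; rewrite eqEcard card_imset ?cX ?leqnn ?andbT;
    last exact: perm_inj.
  by apply/subsetP => _ /imsetP[x xX ->]; rewrite permE XX'.
have cBA : #|B :\: A| = #|B' :\: A'|.
  by rewrite !cardsD (setIidPr AB) (setIidPr AB') cA cB.
have cAB : size (enum A' ++ enum (B' :\: A')) = #|B'|.
  by rewrite size_cat -!cardE cardsD (setIidPr AB') subnKC // subset_leq_card.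
split; apply: sub => // x.
  move=> xA; rewrite /f /s1 /s2 /fl -!catA index_cat mem_enum xA nth_cat.
  have ixA : (index x (enum A) < size (enum A'))%N.
    by rewrite -cardE -cA cardE index_mem mem_enum.
  by rewrite ixA -[_ \in _](mem_enum (pred_of_set A')) mem_nth.
move=> xB; rewrite /f /s1 /s2 /fl index_cat mem_cat !mem_enum !inE xB andbT orbN
  nth_cat.
have ixB : (index x (enum A ++ enum (B :\: A)) < #|B'|)%N.
  have -> : #|B'| = size (enum A ++ enum (B :\: A)).
    by rewrite -cAB !size_cat -!cardE cA cBA.
  by rewrite index_mem mem_cat !mem_enum !inE xB andbT orbN.
rewrite cAB ixB.
have : nth x (enum A' ++ enum (B' :\: A')) (index x (enum A ++ enum (B :\: A)))
   \in enum A' ++ enum (B' :\: A') by rewrite mem_nth // cAB.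
by rewrite mem_cat !mem_enum !inE => /orP[/(subsetP AB')|/andP[]].
Qed.

Section Chains.
Variable n : nat.
Implicit Types (s : 'S_n) (A B : {set 'I_n}) (k : nat).

(** A permutation encodes a maximal chain through its first [k] values. For [k > n] this is the full
    set. *)
Definition chain s k : {set 'I_n} := s @: [set i : 'I_n | (i < k)%N].

Lemma card_chain s k : (k <= n)%N -> #|chain s k| = k.
Proof.
move=> kn; rewrite card_imset; last exact: perm_inj.
rewrite cardsE cardE -(size_map val) /=.
have -> : map val (enum (fun i : 'I_n => (i < k)%N)) = filter
  (fun i => (i < k)%N) (iota 0 n).
  by rewrite -val_enum_ord filter_map enumT.
rewrite -{1}(subnKC kn) iotaD filter_cat size_cat.
rewrite (_ : filter _ (iota 0 k) = iota 0 k); last first.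
  by apply/all_filterP/allP => i; rewrite mem_iota.
rewrite (_ : filter _ _ = [::]) ?size_iota ?addn0 //.
apply/eqP; rewrite -[_ == _]negbK -has_filter; apply/hasPn => i.
by rewrite mem_iota add0n -leqNgt => /andP[].
Qed.

Lemma chain_subset s j k : (j <= k)%N -> chain s j \subset chain s k.
Proof.
by move=> jk; apply: imsetS; apply/subsetP => i; rewrite !inE => /leq_trans; apply.
Qed.

(** By [perm_flag], all flags of the given sizes lie on equally many chains, and each of the $n!$
    chains contains exactly one of them. *)
Lemma card_flag A B : A \subset B ->
  (#|[set s | (chain s #|A| == A) && (chain s #|B| == B)]| *
   ('C(n, #|B|) * 'C(#|B|, #|A|)) = n`!)%N.
Proof.
move=> AB; set a := #|A|; set b := #|B|.
have ab : (a <= b)%N by exact: subset_leq_card.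
have bn : (b <= n)%N by rewrite -[n]card_ord max_card.
have an : (a <= n)%N by exact: leq_trans bn.
pose Q := [pred p : {set 'I_n} * {set 'I_n} |
  [&& p.1 \subset p.2, #|p.1| == a & #|p.2| == b]].
have cnt p : Q p -> #|[set s | (chain s a == p.1) && (chain s b == p.2)]| =
   #|[set s | (chain s a == A) && (chain s b == B)]|.
  case: p => A' B' /= /and3P[AB' /eqP cA /eqP cB].
  have [p [pA pB]] := perm_flag AB AB' (esym cA) (esym cB).
  rewrite -!sum1_card [LHS](reindex_inj (mulIg p)) /=; apply: eq_bigl => s.
  have chainM k : chain (s * p)%g k = p @: chain s k.
    by rewrite /chain -imset_comp; apply: eq_imset => x /=; rewrite permM.
  by rewrite !inE !chainM -pA -pB !(inj_eq (imset_inj (@perm_inj _ p))).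
have cQ : #|Q| = ('C(n, b) * 'C(b, a))%N.
  rewrite -sum1_card -(pair_big_dep (fun=> true) (fun A' B' => Q (A', B'))
    (fun _ _ => 1%N)) /=.
  rewrite (exchange_big_dep (fun B' : {set 'I_n} => #|B'| == b)) /=;
    last by move=> ? ? _ /and3P[].
  rewrite -[n in 'C(n, b)]card_ord -card_draws -sum1_card big_distrl /=.
  rewrite [RHS](eq_bigl (fun B' : {set 'I_n} => #|B'| == b));
    last by move=> B'; rewrite inE.
  apply: eq_bigr => B' /eqP cB'; rewrite mul1n -{2}cB' -cards_draws -sum1_card.
  by apply: eq_bigl => A'; rewrite inE cB' eqxx andbT.
rewrite -cQ mulnC -sum_nat_const -(eq_bigr _ cnt) -card_Sn -sum1_card.
rewrite (partition_big (fun s => (chain s a, chain s b)) Q) /=; last first.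
  by move=> s _; rewrite chain_subset // !card_chain // !eqxx.
apply: eq_bigr => -[A' B'] _ /=; rewrite -sum1_card; apply: eq_bigl => s.
by rewrite inE xpair_eqE.
Qed.

Variable R : realType.

Definition expect (f : 'S_n -> R) : R := (\sum_s f s) / n`!%:R.

(** The probability that a random maximal chain passes through [A]; its sum over a family is the
    Lubell mass. *)
Definition level_weight A : R := 'C(n, #|A|)%:R^-1.
(** For [A \subset B], the probability that the chain passes through both. *)
Definition flag_weight A B : R := ('C(n, #|B|) * 'C(#|B|, #|A|))%:R^-1.

Lemma expect_le f g : (forall s, f s <= g s) -> expect f <= expect g.
Proof.
move=> fg; apply: ler_wpM2r; first by rewrite invr_ge0.
exact: ler_sum.
Qed.

Lemma expectD f g : expect (fun s => f s + g s) = expect f + expect g.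
Proof. by rewrite /expect big_split /= mulrDl. Qed.

Lemma expect_cst (x : R) : expect (fun=> x) = x.
Proof.
rewrite /expect sumr_const card_Sn -[x *+ _]mulr_natr mulfK //.
by rewrite pnatr_eq0 -lt0n fact_gt0.
Qed.

Lemma expect_flag A B : A \subset B ->
  expect (fun s => ((chain s #|A| == A) && (chain s #|B| == B))%:R) = flag_weight A B.
Proof.
move=> AB; rewrite /expect /flag_weight -(card_flag AB) natrM invfM mulrA.
have -> : \sum_s ((chain s #|A| == A) && (chain s #|B| == B))%:R =
   #|[set s | (chain s #|A| == A) && (chain s #|B| == B)]|%:R :> R.
  rewrite -sumr_const [RHS]big_mkcond; apply: eq_bigr => s _.
  by rewrite inE; case: ifP.
rewrite divff ?mul1r //.
by apply/eqP => /eqP; rewrite pnatr_eq0 => /eqP c0; have := card_flag AB;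
  rewrite c0 mul0n => /esym/eqP; rewrite -leqn0 leqNgt fact_gt0.
Qed.

(** A chain has exactly one set on each level, so the count over [k] regroups as a sum over sets
    before averaging. *)
Lemma expect_sum1 (P : pred {set 'I_n}) :
  expect (fun s => (\sum_(k < n.+1) P (chain s k))%:R) =
  \sum_(A | P A) level_weight A.
Proof.
have nA A : (#|A| < n.+1)%N by rewrite ltnS -[n in (_ <= n)%N]card_ord max_card.
pose lev A : 'I_n.+1 := Ordinal (nA A).
have E s : (\sum_(k < n.+1) P (chain s k))%:R =
    \sum_(A | P A) (chain s #|A| == A)%:R :> R.
  rewrite natr_sum [RHS](partition_big lev xpredT) //=.
  apply: eq_bigr => k _.
  have kn : (k <= n)%N by rewrite -ltnS.
  have lk : lev (chain s k) == k by apply/eqP/val_inj; rewrite /= card_chain.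
  case: (boolP (P (chain s k))) => Pk.
    rewrite [RHS](bigD1 (chain s k)) /=; last by rewrite Pk lk.
    rewrite card_chain // eqxx /= big1 ?addr0 // => A /andP[/andP[_ /eqP jA] Aj].
    by rewrite -jA in Aj; rewrite /= in Aj; rewrite eq_sym (negbTE Aj).
  rewrite big1 // => A /andP[PA /eqP jA].
  case: eqP => // cA; case/negP: Pk; by rewrite -jA /= cA.
rewrite /expect (eq_bigr _ (fun s _ => E s)) exchange_big /= mulr_suml;
  apply: eq_bigr => A _.
have := expect_flag (subxx A);
  rewrite /flag_weight binn muln1 -/(level_weight A) => <-.
by congr (_ / _); apply: eq_bigr => s _; rewrite andbb.
Qed.

Lemma expect_sum2 (P : rel {set 'I_n}) :
  expect (fun s => (\sum_(k < n.+1) \sum_(j < k) P (chain s j) (chain s k))%:R) =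
  \sum_(B : {set 'I_n}) \sum_(A : {set 'I_n} | (A \proper B) && P A B)
    flag_weight A B.
Proof.
have nA A : (#|A| < n.+1)%N by rewrite ltnS -[n in (_ <= n)%N]card_ord max_card.
pose lev A : 'I_n.+1 := Ordinal (nA A).
have E s : (\sum_(k < n.+1) \sum_(j < k) P (chain s j) (chain s k))%:R =
    \sum_(B : {set 'I_n}) \sum_(A : {set 'I_n} | (A \proper B) && P A B)
      ((chain s #|A| == A) && (chain s #|B| == B))%:R :> R.
  rewrite natr_sum [RHS](partition_big lev xpredT) //=.
  apply: eq_bigr => k _.
  have kn : (k <= n)%N by rewrite -ltnS.
  rewrite -(big_ord_narrow (F :=
    fun j : 'I_n.+1 => P (chain s j) (chain s k) : nat) (ltnW (ltn_ord k))).
  rewrite natr_sum [RHS](bigD1 (chain s k)) /=;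
    last by apply/eqP/val_inj; rewrite /= card_chain.
  rewrite card_chain // eqxx [X in _ + X]big1 ?addr0; last first.
    move=> B /andP[/eqP kB Bk]; apply: big1 => A _.
    by rewrite -kB in Bk; rewrite /= in Bk;
      rewrite [chain s #|B| == B]eq_sym (negbTE Bk) andbF.
  rewrite [RHS](partition_big lev (fun j : 'I_n.+1 => (j < k)%N)) /=; last first.
    by move=> A /andP[/proper_card]; rewrite card_chain.
  apply: eq_bigr => j jk.
  have jn : (j <= n)%N by rewrite -ltnS.
  have pjk : chain s j \proper chain s k.
    by rewrite properEcard chain_subset ?(ltnW jk) // !card_chain.
  have lj : lev (chain s j) == j by apply/eqP/val_inj; rewrite /= card_chain.
  case: (boolP (P (chain s j) (chain s k))) => Pjk.
    rewrite [RHS](bigD1 (chain s j)) /=; last by rewrite pjk Pjk lj.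
    rewrite card_chain // eqxx /= big1 ?addr0 // => A /andP[/andP[_ /eqP jA] Aj].
    by rewrite -jA in Aj; rewrite /= in Aj; rewrite andbT eq_sym (negbTE Aj).
  rewrite big1 // => A /andP[/andP[_ PA] /eqP jA]; rewrite andbT.
  case: eqP => // cA; case/negP: Pjk; by rewrite -jA /= cA.
rewrite /expect (eq_bigr _ (fun s _ => E s)) exchange_big /= mulr_suml;
  apply: eq_bigr => B _.
rewrite exchange_big /= mulr_suml; apply: eq_bigr => A /andP[/proper_sub AB _].
by rewrite -expect_flag.
Qed.

End Chains.

(** * Deterministic counting along one chain *)

Section LevelCounting.
Variables (f l : nat -> bool) (lo hi : nat).
Let r k := (lo <= k <= hi)%N.
Hypothesis f_range : forall k, f k -> r k.
Local Open Scope nat_scope.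

(** Here [f k] will mean that the set of the chain on level [k] lies in the family, and [l k] that
    it has few members below it. In the two other kinds of pair, level [k] (low) or [j] (high) need
    not carry a member. *)
Definition up_edge j k := [&& f j, l j, f k, ~~ l k & k == j.+1].
Definition low_pair j k := [&& f j, l k & lo <= k <= hi].
Definition high_pair j k := [&& f k, ~~ l j & lo <= j <= hi].

(** The 1 pays for the first low member; each later one forms a low pair with an earlier member. *)
Lemma count_low n :
  \sum_(k < n) (f k && l k) <= 1 + \sum_(k < n) \sum_(j < k) low_pair j k.
Proof.
set X := fun n => \sum_(k < n) (f k && l k).
suff : X n <= (0 < X n) + \sum_(k < n) \sum_(j < k) low_pair j k.
  by move=> H; apply: leq_trans H _; rewrite leq_add2r leq_b1.
elim: n => [|n IHn]; first by rewrite /X big_ord0.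
rewrite {1}/X big_ord_recr /= -/(X n) [\sum_(k < n.+1) _]big_ord_recr /=.
have XS : X n <= X n.+1 by rewrite /X big_ord_recr leq_addr.
case: (boolP (f n && l n)) => [/andP[fn ln]|_];
  last by move: (\sum_(i < n) _) (\sum_(j < n) _) IHn => u v; clearbody X; lia.
have XS1 : X n.+1 = X n + 1 by rewrite /X big_ord_recr /= fn ln.
have [X0|X0] := posnP (X n); first by rewrite XS1 X0.
have [j Hj] : exists j : 'I_n, f j && l j.
  apply/existsP; apply: contraTT X0; rewrite negb_exists => /forallP H.
  by rewrite /X big1 // => i _; rewrite (negbTE (H i)).
have row0 : 0 < \sum_(j < n) low_pair j n.
  rewrite (bigD1 j) //= addn_gt0 lt0b.
  by case/andP: Hj => fj _; rewrite /low_pair fj ln /= -/(r n) (f_range fn).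
rewrite XS1 addn1; move: (\sum_(i < n) _) (\sum_(j < n) _) IHn row0 => u v.
by clearbody X; lia.
Qed.

Lemma count_high n :
  \sum_(k < n) (f k && ~~ l k) <= 1 + \sum_(k < n) \sum_(j < k) high_pair j k.
Proof.
set X := fun n => \sum_(k < n) (f k && ~~ l k).
suff : X n <= (0 < X n) + \sum_(k < n) \sum_(j < k) high_pair j k.
  by move=> H; apply: leq_trans H _; rewrite leq_add2r leq_b1.
elim: n => [|n IHn]; first by rewrite /X big_ord0.
rewrite {1}/X big_ord_recr /= -/(X n) [\sum_(k < n.+1) _]big_ord_recr /=.
have XS : X n <= X n.+1 by rewrite /X big_ord_recr leq_addr.
case: (boolP (f n && ~~ l n)) => [/andP[fn ln]|_];
  last by move: (\sum_(i < n) _) (\sum_(j < n) _) IHn => u v; clearbody X; lia.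
have XS1 : X n.+1 = X n + 1 by rewrite /X big_ord_recr /= fn ln.
have [X0|X0] := posnP (X n); first by rewrite XS1 X0.
have [j Hj] : exists j : 'I_n, f j && ~~ l j.
  apply/existsP; apply: contraTT X0; rewrite negb_exists => /forallP H.
  by rewrite /X big1 // => i _; rewrite (negbTE (H i)).
have row0 : 0 < \sum_(j < n) high_pair j n.
  rewrite (bigD1 j) //= addn_gt0 lt0b.
  by case/andP: Hj => fj lj; rewrite /high_pair fn lj /= -/(r j) (f_range fj).
rewrite XS1 addn1; move: (\sum_(i < n) _) (\sum_(j < n) _) IHn row0 => u v.
by clearbody X; lia.
Qed.

(** Every member [k] after the first is paid for by a pair. If [k] is low, an earlier member gives a
    low pair. Otherwise consider level [k - 1]. If it is not low, it forms a high pair with [k]; if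
    it is a low member, the two form an upward edge; if it is a low gap, an earlier member forms a
    low pair with it. *)
Lemma count_all n :
  \sum_(k < n) f k <= 1 + \sum_(k < n) \sum_(j < k)
     (up_edge j k + low_pair j k + high_pair j k).
Proof.
set X := fun n => \sum_(k < n) f k.
set row := fun k => \sum_(j < k) (up_edge j k + low_pair j k + high_pair j k).
(* A gap level just passed has been paid for but not yet used. *)
pose T n := if n is m.+1 then [&& r m, l m, ~~ f m & 0 < X m] else false.
suff : X n + T n <= (0 < X n) + \sum_(k < n) row k.
  by move=> H; apply: leq_trans (leq_addr _ _) (leq_trans H _);
    rewrite leq_add2r leq_b1.
have rowP j k : j < k -> up_edge j k + low_pair j k + high_pair j k <= row k.
  by move=> jk; rewrite /row (bigD1 (Ordinal jk)) //= leq_addr.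
have XP m : 0 < X m -> exists2 j, j < m & f j.
  move=> X0; have [j Hj] : exists j : 'I_m, f j.
    apply/existsP; apply: contraTT X0; rewrite negb_exists => /forallP H.
    by rewrite /X big1 // => i _; rewrite (negbTE (H i)).
  by exists j.
elim: n => [|n IHn]; first by rewrite /X big_ord0.
have XS : X n.+1 = X n + f n by rewrite /X big_ord_recr.
rewrite XS [\sum_(k < n.+1) _]big_ord_recr /=.
have [X0|X0] := posnP (X n).
  by move: IHn; rewrite X0 /=; case: (f n) => /=; rewrite ?andbF ?ltnn; lia.
have [j jn fj] := XP _ X0.
move: IHn; rewrite X0 andbT addn_gt0 X0 /= => IHn.
have rj := f_range fj.
have := rowP j n jn; rewrite /up_edge /low_pair /high_pair fj /= -/(r n).
case: (boolP (f n)) => fn /=; last first.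
  by rewrite andbT addn0 andbF /= addn0; case: (r n); case: (l n); lia.
rewrite (f_range fn) andbF /= addn0.
case: (boolP (l n)) => [ln|ln] /=; first by lia.
move=> _.
case: n fn ln jn X0 IHn rowP {XS} => // n fn ln jn X0 IHn rowP.
have rn : r n by move: rj (f_range fn); rewrite /r; lia.
have := rowP n n.+1 (leqnn _);
  rewrite /up_edge /low_pair /high_pair fn ln eqxx -/(r n) rn.
move: IHn; rewrite /T rn; case: (boolP (l n)) => /= lln; last by lia.
case: (boolP (f n)) => /= ffn; first by lia.
have -> : 0 < X n.
  by move: X0; rewrite /X big_ord_recr /= (negbTE ffn) addn0.
lia.
Qed.

End LevelCounting.

(** * Averaging the counts over all chains *)

Section ChainInequalities.
Variables (R : realType) (n : nat) (F low : {set {set 'I_n}}) (lo hi : nat).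
Hypothesis F_range : forall A, A \in F -> (lo <= #|A| <= hi)%N.

Local Notation mid A := (lo <= #|A| <= hi)%N.

(** By [expect_sum2], this sum and the next two are the expected numbers of low pairs, high pairs
    and upward edges on a random chain. *)
Definition low_mass : R :=
  \sum_(B : {set 'I_n}) \sum_(A : {set 'I_n} | (A \proper B) &&
    [&& A \in F, B \in low & mid B]) flag_weight R A B.

Definition high_mass : R :=
  \sum_(B : {set 'I_n}) \sum_(A : {set 'I_n} | (A \proper B) &&
    [&& B \in F, A \notin low & mid A]) flag_weight R A B.

Definition edge_mass : R :=
  \sum_(B : {set 'I_n}) \sum_(A : {set 'I_n} | (A \proper B) &&
    [&& A \in F, A \in low, B \in F, B \notin low & #|B| == #|A|.+1]) flag_weight R
      A B.

(** The guard is needed because [chain s k] remains the full set for [k > n]. *)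
Let f s k := (k <= n)%N && (chain s k \in F).
Let l (s : 'S_n) k := chain s k \in low.

Let f_range s k : f s k -> (lo <= k <= hi)%N.
Proof. by case/andP=> kn /F_range; rewrite card_chain. Qed.

Lemma lubell_low : \sum_(A in F | A \in low) level_weight R A <= 1 + low_mass.
Proof.
rewrite -(expect_sum1 _ [pred A | (A \in F) && (A \in low)]).
rewrite /low_mass -(expect_sum2 _ (fun A B => [&& A \in F, B \in low & mid B])).
rewrite -[X in _ <= X + _](@expect_cst n R) -expectD; apply: expect_le => s.
rewrite -[1]/(1%:R) -natrD ler_nat.
have := count_low (l s) (f_range (s := s)) n.+1.
congr (_ <= 1 + _)%N; apply: eq_bigr => k _.
  by rewrite /f /l -ltnS ltn_ord.
have kn : (k <= n)%N by rewrite -ltnS.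
apply: eq_bigr => j _; have jn : (j <= n)%N by apply: leq_trans kn; exact: ltnW.
by rewrite /low_pair /f /l jn /= card_chain.
Qed.

Lemma lubell_high : \sum_(A in F | A \notin low) level_weight R A <= 1 + high_mass.
Proof.
rewrite -(expect_sum1 _ [pred A | (A \in F) && (A \notin low)]).
rewrite /high_mass -(expect_sum2 _ (fun A B => [&& B \in F, A \notin low & mid A])).
rewrite -[X in _ <= X + _](@expect_cst n R) -expectD; apply: expect_le => s.
rewrite -[1]/(1%:R) -natrD ler_nat.
have := count_high (l s) (f_range (s := s)) n.+1.
congr (_ <= 1 + _)%N; apply: eq_bigr => k _.
  by rewrite /f /l -ltnS ltn_ord.
have kn : (k <= n)%N by rewrite -ltnS.
apply: eq_bigr => j _; have jn : (j <= n)%N by apply: leq_trans kn; exact: ltnW.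
by rewrite /high_pair /f /l kn /= card_chain.
Qed.

Lemma lubell_all :
  \sum_(A in F) level_weight R A <= 1 + edge_mass + low_mass + high_mass.
Proof.
rewrite -(expect_sum1 _ [pred A | A \in F]).
rewrite /low_mass -(expect_sum2 _ (fun A B => [&& A \in F, B \in low & mid B])).
rewrite /high_mass -(expect_sum2 _ (fun A B => [&& B \in F, A \notin low & mid A])).
rewrite /edge_mass -(expect_sum2 _ (fun A B =>
   [&& A \in F, A \in low, B \in F, B \notin low & #|B| == #|A|.+1])).
rewrite -[X in _ <= X + _ + _ + _](@expect_cst n R) -!expectD; apply: expect_le => s.
rewrite -[1]/(1%:R) -!natrD ler_nat.
have := count_all (l s) (f_range (s := s)) n.+1.
rewrite -!addnA -!big_split; congr (_ <= 1 + _)%N; apply: eq_bigr => k _.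
  by rewrite /f -ltnS ltn_ord.
have kn : (k <= n)%N by rewrite -ltnS.
rewrite -!big_split; apply: eq_bigr => j _.
have jn : (j <= n)%N by apply: leq_trans kn; exact: ltnW.
by rewrite /up_edge /low_pair /high_pair /f /l kn jn /= !card_chain // addnA.
Qed.

End ChainInequalities.

(** * Embeddings of P(G) into a family *)

Lemma exists_injection (T U : finType) (X : {set U}) : (#|T| <= #|X|)%N ->
  exists2 f : T -> U, injective f & forall x, f x \in X.
Proof.
move=> TX; exists (fun x => enum_val (widen_ord TX (enum_rank x))).
  move=> x y /enum_val_inj /(congr1 val) /= /val_inj; exact: enum_rank_inj.
by move=> x; exact: enum_valP.
Qed.

Section Embedding.
Variables (G : sgraph) (n : nat) (F : {set {set 'I_n}}).

Lemma incidence_embedding (g : incidence_poset G -> {set 'I_n}) :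
    injective g -> (forall u, g u \in F) ->
    (forall u v, incidence_lt u v -> g u \subset g v) ->
  ~ poset_free (incidence_poset G) F.
Proof.
move=> gI gF gM; apply; exists (fun u => Sub (g u) (gF u) : family_poset F).
  by move=> u v /(congr1 val) /=; exact: gI.
move=> u v; rewrite le_eqVlt => /orP[/eqP -> //|uv].
rewrite -Order.le_val /=; exact: (gM u v uv).
Qed.

Definition incidence_size := (#|G| + #|edges G|)%N.

(* Otherwise the vertices go below [M] and the edges above it. *)
Lemma few_below_or_above (M : {set 'I_n}) : poset_free (incidence_poset G) F ->
  (#|[set A in F | A \proper M]| < incidence_size)%N \/
  (#|[set B in F | M \proper B]| < incidence_size)%N.
Proof.
move=> Ffree; apply/orP; apply: contraPT Ffree.
rewrite negb_or -!leqNgt => /andP[mA mB].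
have [f fI fF] : exists2 f : G -> {set 'I_n}, injective f &
    forall x, f x \in [set A in F | A \proper M].
  by apply: exists_injection; apply: leq_trans mA; exact: leq_addr.
have [h hI hF] : exists2 h : {A | A \in edges G} -> {set 'I_n}, injective h &
    forall x, h x \in [set B in F | M \proper B].
  apply: exists_injection; apply: leq_trans mB; rewrite card_sig.
  by rewrite /incidence_size (leq_trans _ (leq_addl _ _)) // leq_eqVlt eqxx.
have fM x : f x \proper M by have := fF x; rewrite inE => /andP[].
have hM x : M \proper h x by have := hF x; rewrite inE => /andP[].
apply: (@incidence_embedding (fun u => match u with inl x => f x | inr a => h a end)).
- move=> [x|x] [y|y].
  + by move/fI => ->.
  + by move=> fh; have := proper_trans (fM x) (hM y); rewrite fh properxx.
  + by move=> fh; have := proper_trans (fM y) (hM x); rewrite fh properxx.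
  + by move/hI => ->.
- by move=> [x|x]; [have := fF x | have := hF x]; rewrite inE => /andP[].
- move=> [x|x] [y|y] //= _; exact: proper_sub (proper_trans (fM x) (hM y)).
Qed.

Lemma card_edge A : A \in edges G -> #|A| = 2%N.
Proof.
case/imsetP => -[x y]; rewrite inE /= => xy ->; rewrite cards2.
by case: eqVneq xy => // ->; rewrite adj_irrefl.
Qed.

(** A vertex goes to [S] plus one point, an edge to [S] plus two. Both are images of subsets of [G],
    and an edge, having two elements, is never a singleton. *)
Lemma link_embedding (S : {set 'I_n}) (phi : G -> 'I_n) : injective phi ->
    (forall x, phi x \notin S) -> (forall x, phi x |: S \in F) ->
    (forall x y, adj x y -> phi x |: (phi y |: S) \in F) ->
  ~ poset_free (incidence_poset G) F.
Proof.
move=> phiI phiS phi1 phi2.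
pose vs (u : incidence_poset G) : {set G} :=
  match u with inl v => [set v] | inr A => val A end.
have vsI : injective vs.
  move=> [x|A] [y|B] /=.
  - by move/set1_inj => ->.
  - by move=> xB; have := card_edge (valP B); rewrite /= -xB cards1.
  - by move=> xB; have := card_edge (valP A); rewrite /= xB cards1.
  - by move=> AB; congr inr; exact: val_inj.
apply: (@incidence_embedding (fun u => phi @: vs u :|: S)).
- move=> u v uv; apply: vsI; apply: (imset_inj phiI).
  have disj X : phi @: X = (phi @: X :|: S) :\: S.
    apply/setP => y; rewrite !inE; case: (boolP (y \in S)) => yS //=;
      last by rewrite orbF.
    by apply/negbTE; apply/imsetP => -[x _ yx]; rewrite yx (negbTE (phiS x)) in yS.
  by rewrite disj uv -disj.
- move=> [x|A] /=; first by rewrite imset_set1.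
  have /imsetP[[x y]] := valP A; rewrite inE /= => xy ->.
  by rewrite imsetU1 imset_set1 -setUA phi2.
- move=> [x|x] [y|y] //= xy; apply: setSU; apply: imsetS.
  by rewrite sub1set.
Qed.

End Embedding.

(** Join [x] and [y] in [U] when [S] with both added lies in [F1]: by [link_embedding] this graph
    contains no [G]. Erdos-Stone applies once [U] has [n0] elements; for smaller [U] the linear term
    covers all pairs. *)
Lemma link_edges (R : realType) (G : sgraph) (r : nat) (d : R) :
    (0 < r)%N -> 0 < d -> colorable G r.+1 ->
  exists n0 : nat, forall n (F F0 F1 : {set {set 'I_n}}) (S U : {set 'I_n}),
    poset_free (incidence_poset G) F -> F0 \subset F -> F1 \subset F ->
    U = [set x | (x \notin S) && (x |: S \in F0)] ->
    #|[set p : 'I_n * 'I_n | [&& p.1 \in U, p.2 \in U, p.1 != p.2 &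
       p.1 |: (p.2 |: S) \in F1]]|%:R <=
    (1 - 1 / r%:R + d) * #|U|%:R ^+ 2 + n0%:R * #|U|%:R.
Proof.
move=> r0 d0 Gcol; have [n0 Hn0] := erdos_stone r0 d0 Gcol.
exists n0 => n F F0 F1 S U Ffree F0F F1F UE; set Q := [set p | _].
have QU : (#|Q| <= #|U| ^ 2)%N.
  rewrite -mulnn -cardsX; apply: subset_leq_card; apply/subsetP => p.
  by rewrite !inE => /and4P[-> -> _ _].
have r1 : 1 / r%:R <= 1 :> R by rewrite ler_pdivrMr ?ltr0n // mul1r ler1n.
have [Un0|n0U] := ltnP #|U| n0.
  apply: le_trans (_ : (#|U| ^ 2)%:R <= _); first by rewrite ler_nat.
  rewrite -mulnn natrM; apply: le_trans (_ : n0%:R * #|U|%:R <= _).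
    by rewrite ler_wpM2r // ler_nat ltnW.
  by rewrite lerDr mulr_ge0 ?exprn_ge0 //; lra.
rewrite leNgt; apply/negP => Qbig.
pose V : finType := {x | x \in U}.
have cV : #|V| = #|U| by rewrite card_sig; apply: eq_card.
pose e : rel V := fun x y => (val x != val y) && (val x |: (val y |: S) \in F1).
have e_sym : symmetric e by move=> x y; rewrite /e eq_sym setUCA.
have Qe : #|[set p : V * V | e p.1 p.2]| = #|Q|.
  have vI : injective (fun p : V * V => (val p.1, val p.2)).
    by move=> [x y] [x' y'] [xx' yy']; congr pair; exact: val_inj.
  rewrite -(card_imset _ vI); apply: eq_card => -[x y].
  apply/imsetP/idP => [[[x' y']]|].
    by rewrite !inE /= => /andP[xy xyF] [-> ->]; rewrite xy xyF (valP x') (valP y').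
  rewrite inE /= => /and4P[xU yU xy xyF].
  exists (exist _ x xU, exist _ y yU) => //.
  by rewrite inE /e /= xy.
have [||phi phiI phiE] := Hn0 V e e_sym; first by rewrite cV.
  rewrite cV Qe; apply: ltW; apply: le_lt_trans Qbig.
  by rewrite lerDl mulr_ge0.
have UP x : x \in U -> (x \notin S) && (x |: S \in F0) by rewrite UE inE.
have phiU x := UP _ (valP (phi x)).
apply: (@link_embedding G n F S (fun x => val (phi x)) _ _ _ _ Ffree).
- by move=> x y xy; apply: phiI; exact: val_inj.
- by move=> x; case/andP: (phiU x).
- by move=> x; case/andP: (phiU x) => _ /(subsetP F0F).
- by move=> x y /phiE /andP[_ /(subsetP F1F)].
Qed.

(** * The Lubell mass of a family near the middle level *)

Lemma card_sqr_offdiag (T : finType) (X : {set T}) :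
  (#|X| ^ 2 = #|X| + #|[set p : T * T | [&& p.1 \in X, p.2 \in X & p.1 != p.2]]|)%N.
Proof.
rewrite -mulnn -cardsX -[LHS](cardsID [set p : T * T | p.1 == p.2]); congr (_ + _)%N.
  have <- : #|[set (x, x) | x in X]| = #|X| by rewrite card_imset // => x y [].
  apply: eq_card => -[x y]; rewrite !inE /=; apply/idP/imsetP.
    by move=> /andP[/andP[xB _] /eqP <-]; exists x.
  by move=> [z zB [-> ->]]; rewrite eqxx zB.
by apply: eq_card => -[x y]; rewrite !inE /= andbC -!andbA.
Qed.

Section LevelWeights.
Variables (R : realType) (n : nat).
Implicit Types (A B S : {set 'I_n}) (x y : 'I_n).

Lemma card_le_n A : (#|A| <= n)%N.
Proof. by rewrite -[n in (_ <= n)%N]card_ord max_card. Qed.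

Lemma bin_card_gt0 A : (0 < 'C(n, #|A|))%N.
Proof. by rewrite bin_gt0 card_le_n. Qed.

Lemma level_weight_ge0 A : 0 <= level_weight R A. Proof. by rewrite invr_ge0. Qed.

Lemma flag_weight_ge0 A B : 0 <= flag_weight R A B. Proof. by rewrite invr_ge0. Qed.

(** Given that the chain passes through [B], its set on the level of [A] is uniform among
    $\binom{|B|}{|A|} \geq |B|$ sets. *)
Lemma flag_weight_le_top A B : A \proper B -> (0 < #|A|)%N ->
  flag_weight R A B <= level_weight R B / #|B|%:R.
Proof.
move=> /proper_card AB A0; rewrite /level_weight /flag_weight natrM invfM.
apply: ler_wpM2l; first by rewrite invr_ge0.
have B0 : (0 < #|B|)%N by lia.
rewrite lef_pV2 ?posrE ?ltr0n ?bin_gt0 ?(ltnW AB) // ler_nat.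
by apply: leq_bin_proper; rewrite A0.
Qed.

Lemma flag_weight_le_bot A B : A \proper B -> (#|B| < n)%N ->
  flag_weight R A B <= level_weight R A / (n - #|A|)%:R.
Proof.
move=> /proper_card AB Bn;
  rewrite /level_weight /flag_weight bin_trinomial ?(ltnW AB) ?(ltnW Bn) //.
rewrite natrM invfM; apply: ler_wpM2l; first by rewrite invr_ge0.
rewrite lef_pV2 ?posrE ?ltr0n ?bin_gt0; [|lia|lia].
by rewrite ler_nat; apply: leq_bin_proper; lia.
Qed.

(** Both sides are the probability that the chain passes through [S] and [x |: S], read upward and
    downward. *)
Lemma level_weight_setU1 x S : x \notin S ->
  level_weight R S / (n - #|S|)%:R = level_weight R (x |: S) / #|S|.+1%:R.
Proof.
move=> xS; have cxS : #|x |: S| = #|S|.+1 by rewrite cardsU1 xS.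
have Sn : (#|S| < n)%N by rewrite -cxS card_le_n.
rewrite /level_weight cxS -!invfM -!natrM; congr (_%:R^-1).
by rewrite mulnC [RHS]mulnC mul_bin_left.
Qed.

Lemma sum_level_weight lo hi :
  \sum_(B : {set 'I_n} | (lo <= #|B| <= hi)%N) level_weight R B <= (hi.+1 - lo)%:R.
Proof.
rewrite -(expect_sum1 R (fun B : {set 'I_n} => (lo <= #|B| <= hi)%N)).
rewrite -[leRHS](@expect_cst n R); apply: expect_le => s; rewrite ler_nat.
have H N : (\sum_(k < N) (lo <= k <= hi)%N <= minn N hi.+1 - lo)%N.
  elim: N => [|N IHN]; first by rewrite big_ord0.
  rewrite big_ord_recr /=; move: (\sum_(k < N) _)%N IHN => u.
  by case: (boolP (lo <= N <= hi)%N) => ?; lia.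
apply: leq_trans (leq_trans (H n.+1) _); last by lia.
rewrite leq_eqVlt; apply/orP; left; apply/eqP.
by apply: eq_bigr => k _; rewrite card_chain // -ltnS.
Qed.

End LevelWeights.

(** * Families confined to a window of levels *)

Section Quantitative.
Variables (R : realType) (G : sgraph) (n : nat) (F : {set {set 'I_n}}).
Variables (lo hi c : nat).
Hypothesis F_free : poset_free (incidence_poset G) F.
Hypothesis F_range : forall A, A \in F -> (lo <= #|A| <= hi)%N.
Hypotheses (c_gt1 : (1 < c)%N) (c_lo : (c <= lo)%N) (c_hi : (hi + c <= n)%N).

Let m := incidence_size G.
Let low : {set {set 'I_n}} :=
  [set M : {set 'I_n} | (#|[set A in F | A \proper M]| < m)%N].
Let F0 := [set A in F | A \in low].
Let F1 := [set A in F | A \notin low].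
(* Bounds the mean number of pairs on a random chain counted by [low_mass] or
   [high_mass]. *)
Let kappa : R := (hi.+1 - lo)%:R * m%:R / c%:R.
Let c0 : 0 < c%:R :> R. Proof. by rewrite ltr0n ltnW. Qed.

(** A low [B] has fewer than [m] members below it, and a chain through [B] meets each with
    probability at most $1/c$. *)
Lemma low_mass_le : low_mass R F low lo hi <= kappa.
Proof.
rewrite /low_mass /kappa -mulrA; apply: le_trans (_ :
    (\sum_(B : {set 'I_n} | (lo <= #|B| <= hi)%N) level_weight R B) *
    (m%:R / c%:R) <= _);
  last by rewrite ler_wpM2r ?sum_level_weight // divr_ge0.
rewrite mulr_suml [leRHS]big_mkcond /=; apply: ler_sum => B _.
case: (boolP (lo <= #|B| <= hi)%N) => midB; last first.
  by rewrite big_pred0 // => A; rewrite !andbF.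
have [Bl|Bl] := boolP (B \in low); last first.
  rewrite big_pred0 => [|A]; last by rewrite /= !andbF.
  by rewrite mulr_ge0 ?level_weight_ge0 // divr_ge0.
apply: le_trans (_ : \sum_(A in [set A in F | A \proper B]) level_weight R B / c%:R
  <= _).
  rewrite [leRHS](eq_bigl
    (fun A : {set 'I_n} => (A \proper B) && [&& A \in F, true & true])); last first.
    by move=> A; rewrite !inE !andbT andbC.
  apply: ler_sum => A /andP[AB /and3P[AF _ _]].
  have /andP[loA _] := F_range AF.
  apply: le_trans (flag_weight_le_top R AB _) _; first by lia.
  apply: ler_wpM2l; first exact: level_weight_ge0.
  by rewrite lef_pV2 ?posrE ?ltr0n ?ler_nat; lia.
rewrite sumr_const -[leLHS]mulr_natr -mulrA ler_wpM2l
  ?level_weight_ge0 // mulrC ler_wpM2r ?invr_ge0 //.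
by rewrite ler_nat ltnW //; move: Bl; rewrite inE.
Qed.

(** Dual to [low_mass_le]: by [few_below_or_above], a set that is not low has few members above
    it. *)
Lemma high_mass_le : high_mass R F low lo hi <= kappa.
Proof.
rewrite /high_mass /kappa -mulrA; apply: le_trans (_ :
    (\sum_(A : {set 'I_n} | (lo <= #|A| <= hi)%N) level_weight R A) *
    (m%:R / c%:R) <= _);
  last by rewrite ler_wpM2r ?sum_level_weight // divr_ge0.
rewrite (exchange_big_dep (fun A : {set 'I_n} => (lo <= #|A| <= hi)%N)) /=;
  last first.
  by move=> B A _ /and3P[_ _ /andP[]].
rewrite mulr_suml; apply: ler_sum => A midA.
have [Al|Al] := boolP (A \in low).
  rewrite big_pred0 => [|B]; last by rewrite /= !andbF.
  by rewrite mulr_ge0 ?level_weight_ge0 // divr_ge0.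
apply: le_trans (_ : \sum_(B in [set B in F | A \proper B]) level_weight R A / c%:R
  <= _).
  rewrite [leRHS](eq_bigl
    (fun B : {set 'I_n} =>
    (A \proper B) && [&& B \in F, true & lo <= #|A| <= hi])%N); last first.
    by move=> B; rewrite !inE midA !andbT andbC.
  apply: ler_sum => B /andP[AB /and3P[BF _ _]].
  have /andP[_ hiB] := F_range BF; have cAB := proper_card AB.
  apply: le_trans (flag_weight_le_bot R AB _) _; first by lia.
  apply: ler_wpM2l; first exact: level_weight_ge0.
  by rewrite lef_pV2 ?posrE ?ltr0n ?ler_nat; lia.
rewrite sumr_const -[leLHS]mulr_natr -mulrA ler_wpM2l
  ?level_weight_ge0 // mulrC ler_wpM2r ?invr_ge0 //.
rewrite ler_nat ltnW //.
by have [H|//] := few_below_or_above A F_free; rewrite inE H in Al.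
Qed.

Let shadow (B : {set 'I_n}) := [set x in B | B :\ x \in F0].
(** The link graph of [S], to which Erdos-Stone is applied, has vertex set [U S] and ordered edges
    [Q S]. *)
Let U (S : {set 'I_n}) := [set x | (x \notin S) && (x |: S \in F0)].
Let Q (S : {set 'I_n}) :=
  [set p : 'I_n * 'I_n | [&& p.1 \in U S, p.2 \in U S, p.1 != p.2 &
  p.1 |: (p.2 |: S) \in F1]].
Let w0 : R := \sum_(A in F0) level_weight R A.
Let w1 : R := \sum_(A in F1) level_weight R A.
Let moment : R := \sum_(B in F1) level_weight R B * (#|shadow B|%:R / #|B|%:R) ^+ 2.

Let F0_range A : A \in F0 -> (lo <= #|A| <= hi)%N.
Proof. by rewrite inE => /andP[/F_range]. Qed.

Let F1_range A : A \in F1 -> (lo <= #|A| <= hi)%N.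
Proof. by rewrite inE => /andP[/F_range]. Qed.

(** On a random chain through [B], the set just below [B] is uniform among the [B :\ x]. *)
Lemma edge_mass_shadow :
  edge_mass R F low <= \sum_(B in F1) level_weight R B * (#|shadow B|%:R / #|B|%:R).
Proof.
rewrite /edge_mass [leRHS]big_mkcond /=; apply: ler_sum => B _.
case: (boolP (B \in F1)) => BF1; last first.
  rewrite big_pred0 // => A; apply/negbTE; apply: contra BF1.
  by case/andP=> _ /and5P[_ _ BF Bl _]; rewrite inE BF.
pose X := [set A : {set 'I_n} | (A \proper B) && ((A \in F0) && (#|B| == #|A|.+1))].
apply: le_trans (_ : \sum_(A in X) level_weight R B / #|B|%:R <= _).
  rewrite [leRHS](eq_bigl (fun A : {set 'I_n} => (A \proper B) &&
    [&& A \in F, A \in low, B \in F, B \notin low & #|B| == #|A|.+1])); last first.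
    by move=> A; move: BF1; rewrite !inE => /andP[-> ->]; rewrite !andbA.
  apply: ler_sum => A /andP[AB /and5P[AF _ _ _ _]].
  by apply: flag_weight_le_top => //; have := F_range AF; lia.
rewrite sumr_const -[leLHS]mulr_natr -mulrA ler_wpM2l
  ?level_weight_ge0 // mulrC ler_wpM2r ?invr_ge0 //.
rewrite ler_nat; apply: leq_trans (leq_imset_card (fun x => B :\ x) _).
apply: subset_leq_card; apply/subsetP => A; rewrite inE => /and3P[AB AF0 /eqP cAB].
have [sAB [x xB xA]] := properP AB.
have AE : A = B :\ x.
  apply/eqP; rewrite eqEcard; apply/andP; split.
    by rewrite subsetD1 sAB xA.
  by move: cAB; rewrite (cardsD1 x) xB add1n => -[->].
by apply/imsetP; exists x => //; rewrite inE xB -AE.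
Qed.

(** Cauchy-Schwarz over [F1], with the square root of [level_weight] put in each factor. *)
Lemma edge_mass_moment : edge_mass R F low ^+ 2 <= w1 * moment.
Proof.
have e0 : 0 <= edge_mass R F low.
  by apply: sumr_ge0 => B _; apply: sumr_ge0 => A _; exact: flag_weight_ge0.
have H := edge_mass_shadow.
apply: le_trans (_ : (\sum_(B in F1) level_weight R B * (#|shadow B|%:R / #|B|%:R))
  ^+ 2 <= _).
  by rewrite lerXn2r // nnegrE (le_trans e0).
have sq B : Num.sqrt (level_weight R B) ^+ 2 = level_weight R B
  by rewrite sqr_sqrtr ?level_weight_ge0.
have := cauchy_schwarz_sum (mem F1) (fun B => Num.sqrt (level_weight R B))
  (fun B => Num.sqrt (level_weight R B) * (#|shadow B|%:R / #|B|%:R)).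
rewrite (eq_bigr (fun B => level_weight R B * (#|shadow B|%:R / #|B|%:R)));
  last first.
  by move=> B _; rewrite mulrA -expr2 sq.
rewrite [X in _ <= X * _ -> _](eq_bigr (fun B => level_weight R B));
  last by move=> B _.
rewrite [X in _ <= _ * X -> _](eq_bigr
  (fun B => level_weight R B * (#|shadow B|%:R / #|B|%:R) ^+ 2)) //.
by move=> B _; rewrite exprMn sq.
Qed.

(** For distinct [x], [y] outside [S], the probability that the chain passes through [S], [y |: S]
    and [x |: (y |: S)]. *)
Let link_weight (S : {set 'I_n}) : R :=
  level_weight R S / ((n - #|S|)%:R * (n - #|S|).-1%:R).

(** Expand the square into ordered pairs from the shadow. The diagonal costs at most [w1 / c]. A
    pair of distinct [x], [y] in the shadow of [B] is an edge in the link of [B :\ x :\ y], and two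
    uses of [level_weight_setU1] match the weights. *)
Lemma moment_le : moment <= w1 / c%:R + \sum_S #|Q S|%:R * link_weight S.
Proof.
pose off (B : {set 'I_n}) :=
  [set p : 'I_n * 'I_n | [&& p.1 \in shadow B, p.2 \in shadow B & p.1 != p.2]].
have sqE B := card_sqr_offdiag (shadow B).
(* Enlarging the weight from $1/|B|^2$ to $1/(|B|(|B|-1))$ makes it agree exactly with
   [link_weight]. *)
pose g (B : {set 'I_n}) : R := level_weight R B / (#|B|%:R * #|B|.-1%:R).
apply: le_trans (_ : \sum_(B in F1) (level_weight R B / c%:R + #|off B|%:R * g B)
  <= _).
  apply: ler_sum => B BF1; have rB := F1_range BF1.
  have b0 : 0 < #|B|%:R :> R by rewrite ltr0n; lia.
  have b1 : 0 < #|B|.-1%:R :> R by rewrite ltr0n; lia.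
  rewrite expr_div_n -natrX sqE natrD mulrDl mulrDr; apply: lerD.
    apply: ler_wpM2l; first exact: level_weight_ge0.
    rewrite expr2 invfM mulrA; apply: le_trans (_ : 1 / #|B|%:R <= _).
      apply: ler_wpM2r; first by rewrite invr_ge0.
      rewrite ler_pdivrMr // mul1r ler_nat; apply: subset_leq_card.
      by apply/subsetP => x; rewrite inE => /andP[].
    by rewrite mul1r lef_pV2 ?posrE // ler_nat; lia.
  rewrite /g mulrCA; apply: ler_wpM2l => //; apply: ler_wpM2l;
    first exact: level_weight_ge0.
  rewrite expr2 lef_pV2 ?posrE ?mulr_gt0 // ler_pM2l // ler_nat; exact: leq_pred.
rewrite big_split /= -mulr_suml lerD2l.
rewrite (eq_bigr (fun B => \sum_(p in off B) g B)); last first.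
  by move=> B _; rewrite sumr_const mulr_natl.
rewrite [leRHS](eq_bigr (fun S => \sum_(p in Q S) link_weight S)); last first.
  by move=> S _; rewrite sumr_const mulr_natl.
rewrite (exchange_big_dep (fun p : 'I_n * 'I_n => p.1 != p.2)) /=; last first.
  by move=> B p _; rewrite inE => /and3P[].
rewrite [leRHS](exchange_big_dep (fun p : 'I_n * 'I_n => p.1 != p.2)) /=; last first.
  by move=> S p _; rewrite inE => /and4P[].
apply: ler_sum => -[x y] /= xy.
rewrite (reindex_onto (fun S : {set 'I_n} => x |: (y |: S))
  (fun B : {set 'I_n} => B :\ x :\ y)) /=; last first.
  move=> B /andP[_]; rewrite inE /= => /and3P[xB yB _].
  move: xB yB; rewrite !inE => /andP[xB _] /andP[yB _].
  apply/setP => z; rewrite !inE.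
  case: (eqVneq z x) => [->|zx] /=; first by rewrite xB.
  by case: (eqVneq z y) => [->|zy] /=; first by rewrite yB.
rewrite le_eqVlt; apply/orP; left; apply/eqP.
have E (S : {set 'I_n}) : x \notin S -> y \notin S
  -> [/\ (x |: (y |: S)) :\ x = y |: S,
   (x |: (y |: S)) :\ y = x |: S & (x |: (y |: S)) :\ x :\ y = S].
  move=> xS yS.
  have E1 : (x |: (y |: S)) :\ x = y |: S by rewrite setU1K // !inE negb_or xy.
  have E2 : (x |: (y |: S)) :\ y = x |: S.
    by rewrite setUCA setU1K // !inE negb_or eq_sym xy.
  by split=> //; rewrite E1 setU1K.
have shE B z : (z \in shadow B) = (z \in B) && (B :\ z \in F0) by rewrite [LHS]inE.
have UE S z : (z \in U S) = (z \notin S) && (z |: S \in F0) by rewrite [LHS]inE.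
have offE B : ((x, y) \in off B) = [&& x \in shadow B, y \in shadow B & x != y].
  by rewrite [LHS]inE.
have QE S : ((x, y) \in Q S) = [&& x \in U S, y \in U S, x != y & x |: (y |: S) \in
  F1].
  by rewrite [LHS]inE.
have notin_S S : (x |: (y |: S)) :\ x :\ y = S -> x \notin S /\ y \notin S.
  by move=> <-; rewrite !inE !eqxx andbF.
apply: eq_big => [S|S /andP[_ /eqP /notin_S[xS yS]]]; last first.
  have xyS : x \notin y |: S by rewrite !inE negb_or xy.
  have cy : #|y |: S| = #|S|.+1 by rewrite cardsU1 yS.
  have cxy : #|x |: (y |: S)| = #|S|.+2 by rewrite cardsU1 xyS cy.
  have nE : (n - #|S|).-1 = (n - #|y |: S|)%N by rewrite cy subnS.
  rewrite /g /link_weight nE cxy /= !invfM !mulrA (level_weight_setU1 R yS).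
  by rewrite [RHS]mulrAC (level_weight_setU1 R xyS) cy.
apply/idP/idP.
  rewrite offE !shE => /andP[/andP[SF1 /and3P[/andP[_ xF] /andP[_ yF] _]] /eqP SE].
  have [xS yS] := notin_S _ SE; have [E1 E2 _] := E S xS yS.
  rewrite E1 in xF; rewrite E2 in yF.
  by rewrite QE !UE xS yS xF yF xy SF1.
rewrite QE !UE => /and4P[/andP[xS xF] /andP[yS yF] _ SF1].
have [E1 E2 E3] := E S xS yS.
by rewrite SF1 offE !shE E1 E2 -E1 E3 E1 xF yF xy eqxx setU11 setU1r ?setU11.
Qed.

(** Each [A] in [F0] arises as [x |: S] once for each of its elements [x], every time with weight
    [level_weight R A / #|A|%:R]. *)
Lemma sum_link_vertices :
  \sum_S level_weight R S * (#|U S|%:R / (n - #|S|)%:R) = w0.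
Proof.
have F0n A : A \in F0 -> (0 < #|A|)%N by move/F0_range; lia.
transitivity (\sum_S \sum_(x in U S) level_weight R (x |: S) / #|x |: S|%:R).
  apply: eq_bigr => S _; rewrite mulrCA.
  rewrite (eq_bigr (fun=> level_weight R S / (n - #|S|)%:R)) ?sumr_const
    ?mulr_natl // => x.
  by rewrite inE => /andP[xS _]; rewrite (level_weight_setU1 R xS) cardsU1 xS.
rewrite (exchange_big_dep xpredT) //=.
transitivity (\sum_(x : 'I_n) \sum_(A in F0 | x \in A) level_weight R A / #|A|%:R).
  apply: eq_bigr => x _.
  rewrite [RHS](reindex_onto (fun S : {set 'I_n} => x |: S)
    (fun A => A :\ x)) /=; last first.
    by move=> A /andP[_ xA]; rewrite setD1K.
  apply: eq_bigl => S; rewrite [LHS]inE setU11 andbT andbC; congr (_ && _).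
  apply/idP/eqP => [xS|<-]; first by rewrite setU1K.
  by rewrite !inE eqxx.
rewrite (exchange_big_dep (mem F0)) /=; last by move=> x A _ /andP[].
apply: eq_bigr => A AF0; rewrite (eq_bigl (mem A)) => [|x]; last by rewrite AF0.
rewrite sumr_const -[LHS]mulr_natr mulfVK // pnatr_eq0 -lt0n; exact: F0n.
Qed.

(** One factor [#|U S| / (n - #|S|)] is kept for [sum_link_vertices]. The other has denominator
    [n - #|S| - 1], at least [c], and so is at most $1 + 1/c$. *)
Lemma moment_link (T : R) (n0 : nat) : 0 <= T ->
    (forall S, #|Q S|%:R <= T * #|U S|%:R ^+ 2 + n0%:R * #|U S|%:R) ->
  moment <= w1 / c%:R + (T * (1 + c%:R^-1) + n0%:R / c%:R) * w0.
Proof.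
move=> T0 HQ; apply: le_trans moment_le _;
  rewrite lerD2l -sum_link_vertices mulr_sumr.
apply: ler_sum => S _.
have [u0|u0] := posnP #|U S|.
  have -> : #|Q S| = 0%N.
    by have := HQ S; rewrite u0 expr0n /= !mulr0 addr0 lern0 => /eqP.
  by rewrite u0 !(mul0r, mulr0).
have [x xU] : exists x, x \in U S by exact/card_gt0P.
have [xS xF0] : x \notin S /\ x |: S \in F0.
  by move: xU; rewrite [x \in U S]inE => /andP.
have := F0_range xF0; rewrite cardsU1 xS => sr.
have un : (#|U S| <= n - #|S|)%N.
  have -> : (n - #|S|)%N = #|~: S| by rewrite [RHS]cardsCs setCK card_ord.
  by apply: subset_leq_card; apply/subsetP => z;
    rewrite [z \in U S]inE in_setC => /andP[].
rewrite /link_weight.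
apply: le_trans (ler_wpM2r _ (HQ S)) _;
  first by rewrite divr_ge0 ?level_weight_ge0 ?mulr_ge0.
have [k kE] : exists k, (n - #|S|)%N = k.+1 by exists (n - #|S|).-1; lia.
(* Adding [x] to [S] gives at most [hi] elements, and [hi + c <= n]. *)
have ck : (c <= k)%N by lia.
rewrite kE /= in un *.
set u : R := #|U S|%:R; have u0' : 0 <= u by [].
have un' : u <= k.+1%:R by rewrite ler_nat.
have k0 : 0 < k%:R :> R by rewrite ltr0n; lia.
have k1 : 0 < k.+1%:R :> R by rewrite ltr0n.
rewrite mulrCA [leRHS]mulrCA; apply: ler_wpM2l; first exact: level_weight_ge0.
have kc : k%:R^-1 <= c%:R^-1 :> R by rewrite lef_pV2 ?posrE // ler_nat.
have -> : (T * u ^+ 2 + n0%:R * u) / (k.+1%:R * k%:R) =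
    (T * (u / k%:R) + n0%:R / k%:R) * (u / k.+1%:R).
  by field; rewrite nat1r !gt_eqF.
apply: ler_wpM2r; first by rewrite divr_ge0.
apply: lerD; apply: ler_wpM2l => //.
apply: le_trans (_ : k.+1%:R / k%:R <= _); first by rewrite ler_pM2r ?invr_gt0.
by rewrite -natr1 mulrDl divff ?gt_eqF // mul1r lerD2l.
Qed.

(** The one-sided counts bound [w0] and [w1] by [1 + kappa]. Hence so is the edge mass, up to the
    root of the moment bound, and [lubell_all] combines the three masses. *)
Lemma lubell_bound (T : R) (n0 : nat) : 0 <= T ->
    (forall S, #|Q S|%:R <= T * #|U S|%:R ^+ 2 + n0%:R * #|U S|%:R) ->
  \sum_(A in F) level_weight R A <= 1 + kappa *+ 2 +
    (1 + kappa) * Num.sqrt (c%:R^-1 + (T * (1 + c%:R^-1) + n0%:R / c%:R)).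
Proof.
move=> T0 HQ; set mu := T * _ + _.
have mu0 : 0 <= mu by rewrite addr_ge0 ?mulr_ge0 ?addr_ge0 ?invr_ge0.
have k0 : 0 <= kappa by rewrite divr_ge0 ?mulr_ge0.
have H0 : w0 <= 1 + kappa.
  rewrite /w0 (eq_bigl (fun A => (A \in F) && (A \in low))) => [|A];
    last by rewrite inE.
  by apply: le_trans (lubell_low R low F_range) _; rewrite lerD2l low_mass_le.
have H1 : w1 <= 1 + kappa.
  rewrite /w1 (eq_bigl (fun A => (A \in F) && (A \notin low))) => [|A];
    last by rewrite inE.
  by apply: le_trans (lubell_high R low F_range) _; rewrite lerD2l high_mass_le.
have w10 : 0 <= w1 by apply: sumr_ge0 => A _; exact: level_weight_ge0.
have e2 : edge_mass R F low ^+ 2 <= (1 + kappa) ^+ 2 * (c%:R^-1 + mu).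
  apply: le_trans edge_mass_moment _; rewrite expr2 -mulrA; apply: ler_pM => //.
    by apply: sumr_ge0 => B _;
      rewrite mulr_ge0 ?level_weight_ge0 // exprn_ge0 // divr_ge0.
  apply: le_trans (moment_link T0 HQ) _; rewrite -/mu mulrDr [_ * mu]mulrC.
  by apply: lerD; [apply: ler_wpM2r; rewrite ?invr_ge0 | exact: ler_wpM2l].
have e : edge_mass R F low <= (1 + kappa) * Num.sqrt (c%:R^-1 + mu).
  have k1 : 0 <= 1 + kappa by rewrite addr_ge0.
  rewrite -[1 + kappa](ger0_norm k1) -sqrtr_sqr -sqrtrM ?sqr_ge0 //.
  apply: le_trans (ler_norm _) _; rewrite -sqrtr_sqr ler_sqrt //.
  by rewrite mulr_ge0 ?sqr_ge0 // addr_ge0 // invr_ge0.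
have := lubell_all R low F_range; have := low_mass_le; have := high_mass_le.
rewrite mulr2n; lra.
Qed.

End Quantitative.

(** Here [n0] depends only on [G], [r] and [d], so its contribution vanishes as [c] grows. *)
Lemma middle_family_bound (R : realType) (G : sgraph) (r : nat) (d : R) :
    (0 < r)%N -> 0 < d -> colorable G r.+1 ->
  exists n0 : nat, forall n (F : {set {set 'I_n}}) lo hi c,
    poset_free (incidence_poset G) F ->
    (forall A, A \in F -> (lo <= #|A| <= hi)%N) ->
    (1 < c)%N -> (c <= lo)%N -> (hi + c <= n)%N ->
  let kappa : R := (hi.+1 - lo)%:R * (incidence_size G)%:R / c%:R in
  \sum_(A in F) level_weight R A <= 1 + kappa *+ 2 + (1 + kappa) *
    Num.sqrt (c%:R^-1 + ((1 - 1 / r%:R + d) * (1 + c%:R^-1) + n0%:R / c%:R)).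
Proof.
move=> r0 d0 Gcol; have [n0 Hn0] := link_edges r0 d0 Gcol.
exists n0 => n F lo hi c Ffree Frange c1 clo chi /=.
have r1 : 1 / r%:R <= 1 :> R by rewrite ler_pdivrMr ?ltr0n // mul1r ler1n.
apply: (lubell_bound Ffree Frange c1 clo chi); first by lra.
by move=> S; apply: (Hn0 n F _ _ S _ Ffree _ _ erefl);
  apply/subsetP => A; rewrite inE => /andP[].
Qed.

(** * Levels far from the middle, and the asymptotic bounds *)

Lemma card_off_levels n t : (t <= n./2)%N ->
  (#|[set A : {set 'I_n} | ~~ (n./2 - t <= #|A| <= n./2 + t)%N]| <=
   n.+1 * 'C(n, n./2 - t))%N.
Proof.
move=> tn; set X := [set A | _].
pose lev (A : {set 'I_n}) : 'I_n.+1 := Ordinal (card_le_n A : (#|A| < n.+1)%N).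
rewrite -sum1_card (partition_big lev xpredT) //=.
apply: leq_trans (_ : (\sum_(k < n.+1) 'C(n, n./2 - t) <= _)%N); last first.
  by rewrite sum_nat_const card_ord.
apply: leq_sum => k _; have kn : (k <= n)%N by rewrite -ltnS.
rewrite sum1_card.
case: (boolP (n./2 - t <= k <= n./2 + t)%N) => kt.
  rewrite eq_card0 // => A; apply/negbTE/negP => /andP[]; rewrite inE => nA /eqP kA.
  by case/negP: nA; rewrite -kA in kt.
apply: leq_trans (_ : ('C(n, k) <= _)%N).
  rewrite -[n in 'C(n, k)]card_ord -card_draws; apply: subset_leq_card.
  by apply/subsetP => A /andP[_ /eqP kA]; rewrite inE -kA.
have [kh|hk] := leqP k (n./2 - t); first by apply: leq_bin_below; lia.
(* Reflect to level [n - k]; the strict inequality [n./2 + t < k] absorbs the parity of [n]. *)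
by rewrite -bin_sub //; apply: leq_bin_below; lia.
Qed.

(** The window is linear in [n], so [bin_tail] with [a] about $n/(4q)$ gains a factor of order $n^2$
    against only [n + 1] levels. *)
Lemma card_off_levels_small (R : realType) (q : nat) (g : R) : (1 < q)%N -> 0 < g ->
  exists N : nat, forall n, (N <= n)%N ->
    #|[set A : {set 'I_n} | ~~ (n./2 - n %/ q <= #|A| <= n./2 + n %/ q)%N]|%:R <=
    g * 'C(n, n./2)%:R.
Proof.
(* The final ratio is at most $8 q^3 / a$, and [a >= A0] brings it below [g]. *)
move=> q1 g0; have q0 := ltnW q1; pose A0 := (Num.truncn ((8 * q ^ 3)%:R / g)).+1.
have HA0 : (8 * q ^ 3)%:R / g < A0%:R by exact: truncnS_gt.
exists (4 * A0 * q)%N => n nA.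
have tA : (4 * A0 <= n %/ q)%N by rewrite leq_divRL.
have nt : (n < (n %/ q).+1 * q)%N by rewrite -ltn_divLR.
have tn2 : (n %/ q <= n./2)%N by rewrite -divn2 leq_div2l.
have := card_off_levels tn2; move: (n %/ q)%N tA nt tn2 => t tA nt tn2 tail.
have A01 : (0 < A0)%N by [].
have ns : (n./2 <= t./2 * q.*2.+1)%N by clearbody A0; nia.
pose a := (t %/ 4)%N.
have aA : (A0 <= a)%N by rewrite leq_divRL // mulnC.
have ats : (a.*2 + t./2 <= t)%N by rewrite /a; lia.
have na : (n.+1 <= 8 * a * q)%N.
  apply: leq_trans nt _; rewrite leq_mul2r; apply/orP; right.
  by clearbody A0; rewrite /a in aA *; lia.
have H := bin_tail q0 ats tn2 ns.
have a0 : 0 < a%:R :> R by rewrite ltr0n; lia.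
have ga : (8 * q ^ 3)%:R <= g * a%:R.
  rewrite -ler_pdivrMl // mulrC; apply: le_trans (ltW HA0) _; by rewrite ler_nat.
rewrite -(ler_pM2r (exprn_gt0 2 a0)).
apply: le_trans (_ : (n.+1 * ('C(n, n./2 - t) * a ^ 2))%:R <= _).
  by rewrite mulnA natrM natrX ler_wpM2r ?exprn_ge0 // ler_nat.
apply: le_trans (_ : ((8 * a * q) * (q ^ 2 * 'C(n, n./2)))%:R <= _).
  by rewrite ler_nat leq_mul.
have -> : ((8 * a * q) * (q ^ 2 * 'C(n, n./2)) = (8 * q ^ 3) * (a * 'C(n, n./2)))%N.
  by rewrite [(q ^ 3)%N]expnS; lia.
have -> : g * 'C(n, n./2)%:R * a%:R ^+ 2 = g * a%:R * (a * 'C(n, n./2))%:R.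
  by rewrite natrM; ring.
by rewrite natrM; exact: ler_wpM2r.
Qed.

Lemma colorable_chromatic G : colorable G (chromatic_number G).
Proof. by rewrite /chromatic_number; case: ex_minnP => k /asboolP. Qed.

Lemma edge_exists G : edges G != set0 -> exists x y : G, adj x y.
Proof. by case/set0Pn => A /imsetP[[x y]]; rewrite inE /= => xy _; exists x, y. Qed.

Lemma chromatic_number_gt1 G : edges G != set0 -> (1 < chromatic_number G)%N.
Proof.
move=> /edge_exists[x [y xy]]; have [c /(_ x y xy)] := colorable_chromatic G.
case: (chromatic_number G) c => [|[|k]] c //; first by case: (c x).
by rewrite !ord1.
Qed.

Lemma La_leP (R : realType) (d : Order.disp_t) (n : nat) (H : porderType d) (b : R) :
  0 <= b -> (forall F : {set {set 'I_n}}, poset_free H F -> #|F|%:R <= b) ->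
  (La n H)%:R <= b.
Proof.
move=> b0 Hb; rewrite /La; elim/big_ind: _ => // [x y xb yb|F /asboolP];
  last exact: Hb.
by case: (leqP x y).
Qed.

(** The middle level is an antichain, while an edge gives P(G) a comparable pair. *)
Lemma La_ge_middle G n : edges G != set0 ->
  ('C(n, n./2) <= La n (incidence_poset G))%N.
Proof.
move=> /edge_exists[x [y xy]].
pose F := [set A : {set 'I_n} | #|A| == n./2].
rewrite -[n in 'C(n, _)]card_ord -card_draws.
apply: (@leq_bigmax_cond _ _ (fun F : {set {set 'I_n}} => #|F|) F).
apply/asboolP => -[f fI fM].
have eA : [set x; y] \in edges G by apply/imsetP; exists (x, y); rewrite ?inE.
pose u : incidence_poset G := inl x; pose v : incidence_poset G :=
  inr (exist (fun A => A \in edges G) _ eA).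
have uv : (u < v)%O by rewrite /Order.lt /=; exact: set21.
have fuv := fM _ _ (ltW uv).
have {}fuv : val (f u) \subset val (f v) by [].
have : val (f u) = val (f v).
  apply/eqP; rewrite eqEcard fuv /=.
  by have := valP (f u); have := valP (f v); rewrite !inE => /eqP -> /eqP ->.
by move/val_inj/fI.
Qed.

Lemma nat_above (R : realType) (x : R) : exists N : nat, x < N%:R.
Proof. exists (Num.truncn x).+1; exact: truncnS_gt. Qed.

Lemma bin_half_gt0 n : (0 < 'C(n, n./2))%N.
Proof. by rewrite bin_gt0; lia. Qed.

Lemma middle_levels_arith n q (t := (n %/ q)%N) (c := (n %/ 8)%N) :
    (7 < q)%N -> (q <= n)%N -> (15 < n)%N ->
  [/\ (1 < c)%N, (c <= n./2 - t)%N, (n./2 + t + c <= n)%N,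
      ((n./2 + t).+1 - (n./2 - t) <= 2 * t + 1)%N &
      (q * (2 * t + 1) <= 3 * n)%N /\ (n <= 16 * c)%N].
Proof.
move=> q8 qn n16; have tc : (t <= c)%N by exact: leq_div2l.
have qt : (t * q <= n)%N by exact: leq_divM.
by split; last split; rewrite /c in tc *; lia.
Qed.

(** Keep the levels within [n %/ q] of the middle and take [c = n %/ 8]. Then [kappa] is at most
    [g], the root at most [s + 2 * g], and the discarded levels cost [g]; the total error is at most
    [8 * g <= e]. *)
Lemma La_incidence_upper (R : realType) (G : sgraph) (r : nat) (e : R) :
    (0 < r)%N -> colorable G r.+1 -> 0 < e ->
  exists N : nat, forall n, (N <= n)%N ->
    (La n (incidence_poset G))%:R <=
    (1 + Num.sqrt (1 - 1 / r%:R) + e) * 'C(n, n./2)%:R.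
Proof.
(* The cap at 1 lets products of errors be bounded linearly in [g]. *)
move=> r0 Gcol e0; pose g := Num.min e 1 / 8.
have [g0 [ge g1]] : 0 < g /\ g * 8 <= e /\ g <= 1.
  have : Num.min e 1 <= e by rewrite ge_min lexx.
  have : Num.min e 1 <= 1 by rewrite ge_min lexx orbT.
  have : 0 < Num.min e 1 by rewrite lt_min e0 ltr01.
  by rewrite /g; lra.
pose tau : R := 1 - 1 / r%:R; pose s := Num.sqrt tau.
have [tau0 tau1] : 0 <= tau /\ tau <= 1.
  have : 1 / r%:R <= 1 :> R by rewrite ler_pdivrMr ?ltr0n // mul1r ler1n.
  have : 0 <= 1 / r%:R :> R by rewrite divr_ge0.
  by rewrite /tau; lra.
have s0 : 0 <= s by exact: sqrtr_ge0.
have s1 : s <= 1 by rewrite -[leRHS]sqrtr1 ler_wsqrtr.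
have d0 : 0 < g ^+ 2 by rewrite exprn_gt0.
(* The Erdos-Stone slack is [g ^+ 2] because it ends up under the square root. *)
have [n0 Hmid] := middle_family_bound r0 d0 Gcol.
set m := incidence_size G in Hmid.
(* For [kappa <= g]: the window has at most [2 * t + 1] levels, with
   [q * (2 * t + 1) <= 3 * n <= 48 * c]. *)
have [q' Hq'] := nat_above (48 * m%:R / g).
pose q := maxn q' 8.
have q8 : (7 < q)%N by rewrite leq_max orbT.
have q1 : (1 < q)%N by exact: leq_trans q8.
have Hq : 48 * m%:R <= g * q%:R.
  rewrite -ler_pdivrMl // mulrC; apply: le_trans (ltW Hq') _.
  by rewrite ler_nat leq_maxl.
have [N1 Htail] := card_off_levels_small q1 g0.
(* The terms in $1/c$ under the root have total coefficient at most [3 + n0], since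
   [1 + tau + g ^+ 2 <= 3]. *)
have [N2 HN2] := nat_above ((3 + n0%:R) / g ^+ 2).
exists (maxn N1 (maxn q (maxn 16 (8 * N2)))) => n.
rewrite geq_max [X in _ && X]geq_max => /and3P[nN1 qn].
rewrite geq_max => /andP[n16 nN2].
pose C : R := 'C(n, n./2)%:R.
have C0 : 0 < C by rewrite ltr0n bin_half_gt0.
rewrite -/tau -/s -/C; apply: La_leP; first by rewrite mulr_ge0 ?ltW //; lra.
move=> F Ffree.
pose t := (n %/ q)%N; pose c := (n %/ 8)%N.
pose mid (A : {set 'I_n}) := (n./2 - t <= #|A| <= n./2 + t)%N.
pose Fm := [set A in F | mid A].
have [c1 c_lo c_hi h1 [h2 h3]] := middle_levels_arith q8 qn n16.
have Fm_free : poset_free (incidence_poset G) Fm.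
  move=> [f fI fM]; apply: Ffree.
  have fF u : val (f u) \in F by have := valP (f u); rewrite inE => /andP[].
  exists (fun u => Sub (val (f u)) (fF u) : family_poset F).
    by move=> u v /(congr1 val) /= /val_inj/fI.
  by move=> u v /fM.
have Fm_range A : A \in Fm -> (n./2 - t <= #|A| <= n./2 + t)%N.
  by rewrite inE => /andP[].
have := Hmid n Fm (n./2 - t)%N (n./2 + t)%N c Fm_free Fm_range c1.
move=> /(_ c_lo c_hi) /=; set kappa := _ / c%:R; rewrite -/tau => Hsum.
have cR : 0 < c%:R :> R by rewrite ltr0n ltnW.
have qR : 0 < q%:R :> R by rewrite ltr0n ltnW.
have kap0 : 0 <= kappa by rewrite divr_ge0 ?mulr_ge0.
have kap : kappa <= g.
  rewrite ler_pdivrMr //.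
  apply: le_trans (_ : (2 * t + 1)%:R * m%:R <= _).
    by rewrite ler_wpM2r // ler_nat.
  rewrite -(ler_pM2l qR) mulrA -natrM.
  apply: le_trans (_ : (3 * n)%:R * m%:R <= _); first by rewrite ler_wpM2r // ler_nat.
  apply: le_trans (_ : (3 * (16 * c))%:R * m%:R <= _).
    by rewrite ler_wpM2r // ler_nat leq_mul.
  have -> : (3 * (16 * c))%:R * m%:R = 48 * m%:R * c%:R :> R by rewrite !natrM; ring.
  by rewrite mulrA [q%:R * g]mulrC ler_wpM2r.
have root : Num.sqrt (c%:R^-1 + ((tau + g ^+ 2) * (1 + c%:R^-1) + n0%:R / c%:R)) <=
    s + 2 * g.
  have sg : 0 <= s + 2 * g by lra.
  rewrite -[leRHS](ger0_norm sg) -sqrtr_sqr; apply: ler_wsqrtr.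
  have ss : s ^+ 2 = tau by rewrite sqr_sqrtr.
  have hc : (3 + n0%:R) * c%:R^-1 <= g ^+ 2.
    rewrite ler_pdivrMr // mulrC -ler_pdivrMr //; apply: le_trans (ltW HN2) _.
    by rewrite ler_nat /c leq_divRL // mulnC.
  have g2 : g ^+ 2 <= 1 by rewrite expr_le1 // ltW.
  have ci : 0 <= c%:R^-1 :> R by rewrite invr_ge0.
  have tc : (tau + g ^+ 2) * c%:R^-1 <= 2 * c%:R^-1 by rewrite ler_wpM2r //; lra.
  have sg0 : 0 <= s * g by rewrite mulr_ge0 // ltW.
  have -> : (s + 2 * g) ^+ 2 = tau + 4 * (s * g) + 4 * g ^+ 2 by rewrite -ss; ring.
  by nra.
have HFm : #|Fm|%:R <= (1 + s + 7 * g) * C.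
  (* Every level weight is at least the inverse of the middle binomial coefficient. *)
  apply: le_trans (_ : (\sum_(A in Fm) level_weight R A) * C <= _).
    rewrite mulr_suml -sumr_const; apply: ler_sum => A _.
    rewrite mulrC ler_pdivlMr ?ltr0n ?bin_card_gt0 // mul1r ler_nat.
    exact: leq_bin_half.
  apply: ler_wpM2r; first exact: ltW.
  apply: le_trans Hsum _.
  apply: le_trans (_ : 1 + kappa *+ 2 + (1 + g) * (s + 2 * g) <= _).
    rewrite lerD2l; apply: ler_pM => //; first by lra.
      exact: sqrtr_ge0.
    by lra.
  have gg : g * g <= g by rewrite ler_piMl // ltW.
  have gs : g * s <= g by rewrite ler_piMr // ltW.
  rewrite mulr2n; nra.
have HF : #|F|%:R <= #|Fm|%:R + g * C.
  apply: le_trans (_ : #|Fm|%:R + #|[set A : {set 'I_n} | ~~ mid A]|%:R <= _).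
    rewrite -natrD ler_nat -(cardsID [set A | mid A] F); apply: leq_add.
      by apply: subset_leq_card; apply/subsetP => A; rewrite !inE.
    by apply: subset_leq_card; apply/subsetP => A; rewrite !inE => /andP[].
  by rewrite lerD2l; exact: Htail.
apply: le_trans HF _.
apply: le_trans (_ : (1 + s + 7 * g) * C + g * C <= _); first by rewrite lerD2r.
rewrite -mulrDl; apply: ler_wpM2r; first exact: ltW.
by lra.
Qed.

(* Passage to the limit *)
From mathcomp Require Import all_classical all_reals all_analysis.
Import numFieldNormedType.Exports.
Local Open Scope classical_set_scope.

Lemma cvg0_eventually_le (R : realType) (u : nat -> R) :
    (forall e, 0 < e -> exists N : nat, forall n, (N <= n)%N -> `|u n| <= e) ->
  u @ \oo --> (0 : R).
Proof.
move=> H; apply/cvgrPdist_le => e /H[N HN]; exists N => // n /= /HN.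
by rewrite sub0r normrN.
Qed.

Theorem theorem4 (R : realType) (G : sgraph) (hG : edges G != finset.set0) :
  (exists2 eps : nat -> R, eps @ \oo --> (0 : R) &
     forall n : nat,
       (La n (incidence_poset G))%:R <=
       (1 + Num.sqrt (1 - 1 / ((chromatic_number G)%:R - 1)) + eps n)
         * 'C(n, n./2)%:R) /\
  (bipartite G ->
     exists2 eps : nat -> R, eps @ \oo --> (0 : R) &
       forall n : nat,
         (La n (incidence_poset G))%:R = (1 + eps n) * 'C(n, n./2)%:R).
Proof.
have C0 n : 0 < 'C(n, n./2)%:R :> R by rewrite ltr0n bin_half_gt0.
split=> [|[A HA]].
  have chi1 := chromatic_number_gt1 hG; have := colorable_chromatic G.
  case: (chromatic_number G) chi1 => // r; rewrite ltnS => r0 Gcol.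
  rewrite -natr1 addrK; set s := Num.sqrt _.
  (* The positive part of the excess makes the bound hold for every [n], also where the asymptotic
     estimate is not yet available. *)
  pose eps n : R := Num.max 0 ((La n (incidence_poset G))%:R / 'C(n, n./2)%:R
    - (1 + s)).
  exists eps => [|n]; last first.
    by rewrite -ler_pdivrMr // addrC -lerBlDr le_max lexx orbT.
  apply: cvg0_eventually_le => e e0.
  have [N HN] := La_incidence_upper r0 Gcol e0.
  exists N => n /HN; rewrite -ler_pdivrMr // addrC -lerBlDr => H.
  by rewrite ger0_norm ?le_max ?lexx // ge_max (ltW e0).
(* With two colours [r = 1] and the square root vanishes; the middle level supplies the matching
   lower bound. *)
have Gcol : colorable G 2.
  exists (fun x => if x \in A then ord0 else ord_max) => x y /HA.
  by case: (x \in A); case: (y \in A).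
pose eps n : R := (La n (incidence_poset G))%:R / 'C(n, n./2)%:R - 1.
exists eps => [|n]; last by rewrite addrC subrK divfK // gt_eqF.
apply: cvg0_eventually_le => e e0.
have [N HN] := La_incidence_upper (ltn0Sn 0) Gcol e0.
exists N => n /HN; rewrite divr1 subrr sqrtr0 addr0 -ler_pdivrMr // -lerBlDl => H.
rewrite ger0_norm // subr_ge0 ler_pdivlMr // mul1r ler_nat.
exact: La_ge_middle.
Qed.
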